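(* Let $k,b,n,c,m\in\mathbb{N}^*$ with $k,bn,cm\geq 2$ and $n\wedge m=1$. In $W_b^c(k,bn,cm)$ put $\Delta:=(x_1\cdots x_n y)^m z^n$. Then: (1) There is a short exact sequence $$1\to\langle\Delta\rangle\to W_b^c(k,bn,cm)\to W^+_{k,bn,cm}\to 1,$$ where the map $\langle \Delta\rangle\to W_b^c(k,bn,cm)$ is the inclusion. (2) The center of $W_b^c(k,bn,cm)$ is cyclic, generated by $\Delta$. In particular, the group $W_b^c(k,bn,cm)$ is a central extension of $W^+_{k,bn,cm}$ by the subgroup $\langle\Delta\rangle$.
   Context: $\mathbb{N}^*$ is the set of positive integers and $n\wedge m$ denotes the gcd of $n$ and $m$. For integers $k,n,m\geq 2$, $J(k,n,m)$ is the group with presentation $\langle s,t,u\mid s^k=t^n=u^m=1,\ stu=tus=ust\rangle$; $s,t,u$ are its canonical generators. For $k,b,n,c,m\in\mathbb{N}^*$ with $k,bn,cm\geq 2$ and $n\wedge m=1$, $W_b^c(k,bn,cm)$ denotes the normal closure of $\{s,t^n,u^m\}$ in $J(k,bn,cm)$, where $s,t,u$ are the canonical generators of $J(k,bn,cm)$ (the notation records the tuple $(k,b,n,c,m)$, not just the products). In $W_b^c(k,bn,cm)$ one sets $x_i:=t^{i-1}st^{1-i}$ for $i=1,\dots,n$, $y:=t^n$ and $z:=u^m$. For integers $k,n,m\geq 2$, $W^+_{k,n,m}$ is the alternating subgroup (elements of even length) of the triangle Coxeter group with edge labels $k,n,m$; equivalently it is the group with presentation $\langle \alpha,\beta\mid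 \alpha^k=\beta^n=(\beta\alpha^{-1})^m=1\rangle$. *)

(* Defs.v *)
From HB Require Import structures.
Set Warnings "-notation-overridden,-redundant-canonical-projection,-projection-no-head-constant".
From mathcomp Require Import all_boot boolp classical_sets.

Set Implicit Arguments.
Unset Strict Implicit.
Unset Printing Implicit Defensive.

Local Open Scope classical_set_scope.
Local Open Scope group_scope.
Local Open Scope quotient_scope.

Section Subgroups.
Variable G : groupType.

Definition is_subgroup (A : set G) : Prop :=
  [/\ A 1, forall x y, A x -> A y -> A (x * y) & forall x, A x -> A x^-1].

Definition is_normal_subgroup (A : set G) : Prop :=
  is_subgroup A /\ forall x g, A x -> A (g * x * g^-1).

Record subgroup := Subgroup {
  subgroup_set :> set G;
  subgroupP : is_subgroup subgroup_set }.

Definition subgroup_type (H : subgroup) : Type := set_type H.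

Lemma subgroup_closed (H : subgroup) : group_closed (mem (subgroup_set H)).
Proof.
case: (subgroupP H) => H1 HM HV.
split; first by rewrite in_setE.
by move=> x y; rewrite !in_setE => Hx Hy; apply: HM => //; apply: HV.
Qed.

HB.instance Definition _ (H : subgroup) := SubChoice.on (subgroup_type H).
HB.instance Definition _ (H : subgroup) :=
  SubChoice_isSubGroup.Build G _ (subgroup_type H) (@subgroup_closed H).

Definition subgroup_elt (H : subgroup) x (Hx : subgroup_set H x) :
  subgroup_type H := exist _ x (mem_set Hx).

Definition subgroup_incl (H : subgroup) (x : subgroup_type H) : G := \val x.

Fact subgroup_incl_morph (H : subgroup) : monoid_morphism (@subgroup_incl H).
Proof. by split. Qed.

HB.instance Definition _ (H : subgroup) :=
  isUMagmaMorphism.Build (subgroup_type H) G (@subgroup_incl H)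
    (@subgroup_incl_morph H).

Lemma smallest_is_subgroup (A : set G) :
  is_subgroup (smallest is_subgroup A).
Proof.
split=> [B [[] //]|x y Ax Ay B BA|x Ax B BA].
  by have [[_ M _] _] := BA; apply: M; [apply: Ax | apply: Ay].
by have [[_ _ V] _] := BA; apply: V; apply: Ax.
Qed.

Definition generated (A : set G) : subgroup :=
  Subgroup (smallest_is_subgroup A).

Definition cyclic_subgroup (x : G) : subgroup := generated [set x].

Lemma smallest_is_normal (A : set G) :
  is_normal_subgroup (smallest is_normal_subgroup A).
Proof.
split; last first.
  by move=> x g Ax B BA; have [[_ N] _] := BA; apply: N; apply: Ax.
split=> [B [[[]] //]|x y Ax Ay B BA|x Ax B BA].
  by have [[[_ M _] _] _] := BA; apply: M; [apply: Ax | apply: Ay].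
by have [[[_ _ V] _] _] := BA; apply: V; apply: Ax.
Qed.

Definition normal_closure (A : set G) : subgroup :=
  Subgroup (proj1 (smallest_is_normal A)).

Definition center : set G := [set x | forall y, x * y = y * x].

End Subgroups.

Arguments center G : clear implicits.
Arguments subgroup_incl {G} H x.

Notation grp_morphism := monoid.UMagmaMorphism.type.

Definition short_exact (A B C : groupType)
    (i : grp_morphism A B) (p : grp_morphism B C) : Prop :=
  [/\ injective i, range i = [set b | p b = 1] & range p = setT].

Definition central_extension (A B C : groupType)
    (i : grp_morphism A B) (p : grp_morphism B C) : Prop :=
  short_exact i p /\ range i `<=` center B.

Section Presentations.
Variable I : choiceType.

(* Words in the letters i and i^-1; (i, true) stands for i^-1. *)
Definition word := seq (I * bool).

Definition letter (i : I) : I * bool := (i, false).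
Definition letterV (a : I * bool) : I * bool := (a.1, ~~ a.2).
Definition wordV (w : word) : word := rev (map letterV w).

Variable rels : seq (word * word).

Inductive word_eq : word -> word -> Prop :=
| word_eq_refl w : word_eq w w
| word_eq_sym w1 w2 : word_eq w1 w2 -> word_eq w2 w1
| word_eq_trans w1 w2 w3 : word_eq w1 w2 -> word_eq w2 w3 -> word_eq w1 w3
| word_eq_cat w1 w1' w2 w2' :
    word_eq w1 w1' -> word_eq w2 w2' -> word_eq (w1 ++ w2) (w1' ++ w2')
| word_eq_cancel a : word_eq [:: a; letterV a] [::]
| word_eq_rel r : r \in rels -> word_eq r.1 r.2.

Definition word_eqb (w1 w2 : word) : bool := `[< word_eq w1 w2 >].

Fact word_eqb_refl : reflexive word_eqb.
Proof. by move=> w; apply/asboolP; apply: word_eq_refl. Qed.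
Fact word_eqb_sym : symmetric word_eqb.
Proof. by move=> w1 w2; apply: asbool_equiv_eq; split; apply: word_eq_sym. Qed.
Fact word_eqb_trans : transitive word_eqb.
Proof.
move=> w2 w1 w3 /asboolP e1 /asboolP e2.
by apply/asboolP; apply: word_eq_trans e2.
Qed.

Canonical word_equiv :=
  EquivRel word_eqb word_eqb_refl word_eqb_sym word_eqb_trans.

Definition presented_group := {eq_quot word_equiv}.

HB.instance Definition _ := Choice.on presented_group.
HB.instance Definition _ := EqQuotient.on presented_group.

Definition class_of_word (w : word) : presented_group :=
  \pi_({eq_quot word_equiv}) w.

Lemma class_of_word_eq w1 w2 :
  class_of_word w1 = class_of_word w2 <-> word_eq w1 w2.
Proof. by split=> [/eqmodP/asboolP | /asboolP e] //; apply/eqmodP. Qed.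

Lemma letterVK : involutive letterV.
Proof. by case=> i b; rewrite /letterV /= negbK. Qed.

Lemma wordVK : involutive wordV.
Proof. by move=> w; rewrite /wordV map_rev revK mapK //; exact: letterVK. Qed.

Lemma wordV_cat w1 w2 : wordV (w1 ++ w2) = wordV w2 ++ wordV w1.
Proof. by rewrite /wordV map_cat rev_cat. Qed.

Lemma word_eq_mulV w : word_eq (w ++ wordV w) [::].
Proof.
elim: w => [|a w IH]; first exact: word_eq_refl.
rewrite /wordV /= rev_cons -cats1 -cat_cons catA -/(wordV w).
apply: word_eq_trans (word_eq_cancel a).
apply: (@word_eq_cat ([:: a] ++ (w ++ wordV w)) ([:: a] ++ [::])).
  by apply: word_eq_cat => //; apply: word_eq_refl.
exact: word_eq_refl.
Qed.

Lemma word_eq_wordV w1 w2 : word_eq w1 w2 -> word_eq (wordV w1) (wordV w2).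
Proof.
move=> e; have r := word_eq_refl.
apply: (@word_eq_trans _ (wordV w1 ++ (w2 ++ wordV w2))).
  rewrite -[X in word_eq X _]cats0; apply: word_eq_cat => //.
  exact: word_eq_sym (word_eq_mulV w2).
rewrite catA -[X in word_eq _ X]cat0s; apply: word_eq_cat => //.
apply: (@word_eq_trans _ (wordV w1 ++ w1)).
  by apply: word_eq_cat => //; apply: word_eq_sym.
by rewrite -[X in _ ++ X]wordVK; apply: word_eq_mulV.
Qed.

Definition pres_one : presented_group := class_of_word [::].
Definition pres_mul (x y : presented_group) : presented_group :=
  class_of_word (repr x ++ repr y).
Definition pres_inv (x : presented_group) : presented_group :=
  class_of_word (wordV (repr x)).

Lemma class_of_repr x : class_of_word (repr x) = x.
Proof. exact: reprK. Qed.

Lemma repr_class w : word_eq (repr (class_of_word w)) w.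
Proof. by apply/class_of_word_eq; rewrite class_of_repr. Qed.

Lemma pres_mulE w1 w2 :
  pres_mul (class_of_word w1) (class_of_word w2) = class_of_word (w1 ++ w2).
Proof. by apply/class_of_word_eq/word_eq_cat; apply: repr_class. Qed.

Lemma pres_invE w : pres_inv (class_of_word w) = class_of_word (wordV w).
Proof. by apply/class_of_word_eq/word_eq_wordV; apply: repr_class. Qed.

Fact pres_mulA : associative pres_mul.
Proof.
move=> x y z; rewrite -[x]class_of_repr -[y]class_of_repr -[z]class_of_repr.
by rewrite !pres_mulE catA.
Qed.
Fact pres_mul1 : left_id pres_one pres_mul.
Proof. by move=> x; rewrite -[x]class_of_repr pres_mulE. Qed.
Fact pres_mulr1 : right_id pres_one pres_mul.
Proof. by move=> x; rewrite -[x]class_of_repr pres_mulE cats0. Qed.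
Fact pres_mulrV : right_inverse pres_one pres_inv pres_mul.
Proof.
move=> x; rewrite -[x]class_of_repr pres_invE pres_mulE.
by apply/class_of_word_eq/word_eq_mulV.
Qed.
Fact pres_mulV : left_inverse pres_one pres_inv pres_mul.
Proof.
move=> x; rewrite -[x]class_of_repr pres_invE pres_mulE.
by apply/class_of_word_eq; rewrite -[X in _ ++ X]wordVK; apply: word_eq_mulV.
Qed.

HB.instance Definition _ := isGroup.Build presented_group
  pres_mulA pres_mul1 pres_mulr1 pres_mulV pres_mulrV.

Definition pres_gen (i : I) : presented_group := class_of_word [:: letter i].

End Presentations.

Section TriangleGroups.
Variables k n m : nat.

Local Notation l i := (letter (inord i : 'I_3)).

(* The edges {0, 1}, {0, 2}, {1, 2} carry the labels k, n, m, so that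
   alpha = r_0 r_1 and beta = r_0 r_2 satisfy alpha^k = beta^n = 1 and
   beta alpha^-1 is conjugate to r_2 r_1, hence (beta alpha^-1)^m = 1. *)
Definition triangle_rels : seq (word 'I_3 * word 'I_3) :=
  [:: ([:: l 0; l 0], [::]); ([:: l 1; l 1], [::]); ([:: l 2; l 2], [::]);
      (flatten (nseq k [:: l 0; l 1]), [::]);
      (flatten (nseq n [:: l 0; l 2]), [::]);
      (flatten (nseq m [:: l 1; l 2]), [::])].

Definition triangle_group := presented_group triangle_rels.
HB.instance Definition _ := Group.on triangle_group.

Definition tri_gen (i : 'I_3) : triangle_group := pres_gen triangle_rels i.

Definition tri_prod (v : seq 'I_3) : triangle_group := \prod_(i <- v) tri_gen i.

Lemma tri_gen_word (i : 'I_3) (b : bool) :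
  tri_gen i = class_of_word triangle_rels [:: (i, b)].
Proof.
have ii : word_eq triangle_rels [:: letter i; letter i] [::].
  have -> : i = inord i by rewrite inord_val.
  case: i => -[|[|[|i]]] //= _.
  - by apply: (@word_eq_rel _ _ ([:: l 0; l 0], [::])); rewrite !inE eqxx.
  - by apply: (@word_eq_rel _ _ ([:: l 1; l 1], [::])); rewrite !inE eqxx ?orbT.
  - by apply: (@word_eq_rel _ _ ([:: l 2; l 2], [::])); rewrite !inE eqxx ?orbT.
case: b => //; apply/class_of_word_eq.
apply: (@word_eq_trans _ _ _ ([:: letter i] ++ [:: letter i; letterV (letter i)])).
  rewrite -[X in word_eq _ X _]cats0; apply: word_eq_cat.
    exact: word_eq_refl.
  exact/word_eq_sym/word_eq_cancel.
rewrite -[X in word_eq _ _ X]cat0s.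
by apply: (word_eq_cat (w1 := [:: letter i; letter i]) (w2 := [:: (i, true)]) ii);
  apply: word_eq_refl.
Qed.

Lemma tri_prod_map (w : word 'I_3) :
  class_of_word triangle_rels w = tri_prod [seq a.1 | a <- w].
Proof.
elim: w => [|[i b] w IH]; first by rewrite /tri_prod big_nil.
rewrite /tri_prod /= big_cons -/(tri_prod _) -IH (tri_gen_word i b).
by rewrite [RHS]pres_mulE.
Qed.

Lemma tri_length_subproof (g : triangle_group) :
  exists d, `[< exists2 v, size v = d & g = tri_prod v >].
Proof.
exists (size (repr g)); apply/asboolP; exists [seq a.1 | a <- repr g].
  by rewrite size_map.
by rewrite -tri_prod_map class_of_repr.
Qed.

Definition tri_length (g : triangle_group) : nat :=
  ex_minn (tri_length_subproof g).

Lemma tri_rels_parity (w1 w2 : word 'I_3) :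
  word_eq triangle_rels w1 w2 -> odd (size w1) = odd (size w2).
Proof.
elim=> {w1 w2} // [w1 w2 w3 _ -> _ -> //|w1 w1' w2 w2' _ e1 _ e2|r].
  by rewrite !size_cat !oddD e1 e2.
have odd2 a b j : odd (size (flatten (nseq j [:: a : 'I_3 * bool; b]))) = false.
  by elim: j => //= j ->.
by rewrite !inE => /or4P[/eqP->|/eqP->|/eqP->|/or3P[] /eqP->] //=; exact: odd2.
Qed.

Lemma tri_prod_word (v : seq 'I_3) :
  tri_prod v = class_of_word triangle_rels [seq letter i | i <- v].
Proof. by rewrite tri_prod_map -map_comp map_id. Qed.

Lemma odd_tri_length (v : seq 'I_3) : odd (tri_length (tri_prod v)) = odd (size v).
Proof.
rewrite /tri_length; case: ex_minnP => d /asboolP[v' <-] + _.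
rewrite !tri_prod_word => /class_of_word_eq/tri_rels_parity.
by rewrite !size_map.
Qed.

Lemma tri_prodP (g : triangle_group) : exists v, g = tri_prod v.
Proof.
by exists [seq a.1 | a <- repr g]; rewrite -tri_prod_map class_of_repr.
Qed.

Lemma even_length_subgroup :
  is_subgroup [set g : triangle_group | ~~ odd (tri_length g)].
Proof.
have M x y : odd (tri_length (x * y)) = odd (tri_length x) (+) odd (tri_length y).
  have [v ->] := tri_prodP x; have [v' ->] := tri_prodP y.
  by rewrite -big_cat -/(tri_prod _) !odd_tri_length size_cat oddD.
have O : odd (tri_length 1) = false.
  by have := odd_tri_length [::]; rewrite /tri_prod big_nil.
split=> [|x y|x] /=; first by rewrite O.
  by rewrite M => /negPf-> /negPf->.
by move=> /negPf xE; have := M x x^-1; rewrite mulgV O xE addFb => <-.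
Qed.

Definition alternating_subgroup : subgroup triangle_group :=
  Subgroup even_length_subgroup.

Definition Wplus := subgroup_type alternating_subgroup.
HB.instance Definition _ := Group.on Wplus.

End TriangleGroups.

Section JGroup.
Variables k n m : nat.

Local Notation s := (letter (inord 0 : 'I_3)).
Local Notation t := (letter (inord 1 : 'I_3)).
Local Notation u := (letter (inord 2 : 'I_3)).

Definition J_rels : seq (word 'I_3 * word 'I_3) :=
  [:: (nseq k s, [::]); (nseq n t, [::]); (nseq m u, [::]);
      ([:: s; t; u], [:: t; u; s]); ([:: t; u; s], [:: u; s; t])].

Definition J := presented_group J_rels.
HB.instance Definition _ := Group.on J.

Definition Js : J := pres_gen J_rels (inord 0).
Definition Jt : J := pres_gen J_rels (inord 1).
Definition Ju : J := pres_gen J_rels (inord 2).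

End JGroup.

Section WGroup.
(* W_b^c(k, bn, cm) is [W k b n c m]. *)
Variables k b n c m : nat.

Local Notation s := (Js k (b * n) (c * m)).
Local Notation t := (Jt k (b * n) (c * m)).
Local Notation u := (Ju k (b * n) (c * m)).

Definition W_subgroup : subgroup (J k (b * n) (c * m)) :=
  normal_closure [set s; t ^+ n; u ^+ m].

Definition W := subgroup_type W_subgroup.
HB.instance Definition _ := Group.on W.

Lemma W_x_subproof i : subgroup_set W_subgroup (t ^+ i.-1 * s * t ^- i.-1).
Proof.
by case: (smallest_is_normal [set s; t ^+ n; u ^+ m]) => _; apply;
  apply: sub_gen_smallest; left; left.
Qed.
Lemma W_y_subproof : subgroup_set W_subgroup (t ^+ n).
Proof. by apply: sub_gen_smallest; left; right. Qed.
Lemma W_z_subproof : subgroup_set W_subgroup (u ^+ m).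
Proof. by apply: sub_gen_smallest; right. Qed.

(* Meaningful for i >= 1 only. *)
Definition W_x (i : nat) : W := subgroup_elt (W_x_subproof i).
Definition W_y : W := subgroup_elt W_y_subproof.
Definition W_z : W := subgroup_elt W_z_subproof.

Definition W_Delta : W :=
  ((\prod_(1 <= i < n.+1) W_x i) * W_y) ^+ m * W_z ^+ n.

End WGroup.

(* Main.v *)
From Stdlib Require Import Reals Lra.
Require Import Defs.
From HB Require Import structures.
Set Warnings "-notation-overridden,-redundant-canonical-projection,-projection-no-head-constant,-overwriting-delimiting-key".
From mathcomp Require Import all_boot zmodp boolp classical_sets.

(* Write zeta = stu; it is central in J = J(k,bn,cm).

   Exactness. J/<zeta> is the von Dyck group, and it embeds in the triangle
   group by s -> r1 r0, t -> r0 r2, u -> r2 r1. The quotient J/W is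
   Z/n x Z/m = Z/nm, generated by the image of zeta, so J = W <zeta> and
   W meets <zeta> exactly in the powers of zeta^(nm) = Delta.

   Center. It must be shown that an element z of W central in W dies in the
   triangle group. If at most one label is 2, let the triangle group act on R^3
   by the dual of the Tits reflection representation: the image of z preserves
   every coordinate axis (the fixed line of some r_i r_j), its three eigenvalues
   agree because labels >= 3 couple the axes, and they have product 1 because z
   is even. So z fixes (1,1,1), whose stabilizer is trivial by Tits' argument.
   If two labels are 2, every element of J is a^i b^d zeta^j for the rotation a
   and a half-turn b, and the commutation of z with elements of W is evaluated
   in a monomial group of 2 x 2 matrices. *)

Set Implicit Arguments.
Unset Strict Implicit.
Unset Printing Implicit Defensive.

Local Open Scope classical_set_scope.
Local Open Scope group_scope.

(** * Presented groups and semidirect products *)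

Section PresentedGroups.
Variables (I : choiceType) (rels : seq (word I * word I)).
Local Notation P := (presented_group rels).

Lemma class_of_word_cat (w1 w2 : word I) :
  class_of_word rels (w1 ++ w2) = class_of_word rels w1 * class_of_word rels w2.
Proof. by rewrite -[RHS]/(pres_mul _ _) pres_mulE. Qed.

Lemma class_of_word_letter (a : I * bool) :
  class_of_word rels [:: a] =
  if a.2 then (pres_gen rels a.1)^-1 else pres_gen rels a.1.
Proof.
case: a => i [] //=; rewrite -[RHS]/(pres_inv _) /pres_gen pres_invE //.
Qed.

Lemma presented_rel (r : word I * word I) : r \in rels ->
  class_of_word rels r.1 = class_of_word rels r.2.
Proof. by move=> rr; apply/class_of_word_eq/word_eq_rel. Qed.

Lemma presented_ind (Q : P -> Prop) : Q 1 ->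
  (forall i g, Q g -> Q (pres_gen rels i * g)) ->
  (forall i g, Q g -> Q ((pres_gen rels i)^-1 * g)) -> forall g, Q g.
Proof.
move=> Q1 QM QV g; rewrite -(class_of_repr g); elim: (repr g) => [//|[i c] w IH].
rewrite -cat1s class_of_word_cat class_of_word_letter /=.
by case: c; [apply: QV | apply: QM].
Qed.

Variables (G : groupType) (f : I -> G).

Definition word_eval (w : word I) : G :=
  \prod_(a <- w) (if a.2 then (f a.1)^-1 else f a.1).

Lemma word_eval_cat w1 w2 : word_eval (w1 ++ w2) = word_eval w1 * word_eval w2.
Proof. by rewrite /word_eval big_cat. Qed.

Lemma word_eval_letter i w : word_eval (letter i :: w) = f i * word_eval w.
Proof. by rewrite /word_eval big_cons. Qed.

Lemma word_eval0 : word_eval [::] = 1.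
Proof. by rewrite /word_eval big_nil. Qed.

Lemma word_eval_flatten j w : word_eval (flatten (nseq j w)) = word_eval w ^+ j.
Proof.
by elim: j => [|j IH]; rewrite ?word_eval0 //= word_eval_cat IH expgS.
Qed.

Lemma word_eval_nseq j i : word_eval (nseq j (letter i)) = f i ^+ j.
Proof.
elim: j => [|j IH]; first by rewrite word_eval0.
by rewrite [LHS]word_eval_letter IH expgS.
Qed.

Hypothesis f_rels : {in rels, forall r, word_eval r.1 = word_eval r.2}.

Lemma word_eval_eq w1 w2 : word_eq rels w1 w2 -> word_eval w1 = word_eval w2.
Proof.
elim=> {w1 w2} // [w1 w2 w3 _ -> _ -> //|w1 w1' w2 w2' _ e1 _ e2|[i c]].
  by rewrite !word_eval_cat e1 e2.
by rewrite /word_eval big_cons big_seq1 big_nil; case: c; rewrite /= gsimp.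
Qed.

(** The proof that the relations hold is an argument so that the morphism instance below can be
    attached to the term [pres_hom f_rels]. *)
Definition pres_hom of {in rels, forall r, word_eval r.1 = word_eval r.2} :=
  fun x : P => word_eval (repr x).

Lemma pres_hom_class w : pres_hom f_rels (class_of_word rels w) = word_eval w.
Proof. exact/word_eval_eq/repr_class. Qed.

Lemma pres_hom_gen i : pres_hom f_rels (pres_gen rels i) = f i.
Proof. by rewrite pres_hom_class word_eval_letter word_eval0 mulg1. Qed.

Fact pres_hom_morph : monoid_morphism (pres_hom f_rels).
Proof.
split=> [|x y]; first by rewrite [LHS](pres_hom_class [::]) word_eval0.
rewrite -[x]class_of_repr -[y]class_of_repr -class_of_word_cat.
by rewrite !pres_hom_class word_eval_cat.
Qed.

HB.instance Definition _ :=
  isUMagmaMorphism.Build P G (pres_hom f_rels) pres_hom_morph.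

End PresentedGroups.

Lemma class_of_wordE (I : choiceType) (rels : seq (word I * word I)) w :
  class_of_word rels w = word_eval (pres_gen rels) w.
Proof.
elim: w => [|a w IH]; first by rewrite word_eval0.
by rewrite -cat1s class_of_word_cat IH word_eval_cat class_of_word_letter
  /word_eval big_seq1.
Qed.

(** * Semidirect product with a group of order two *)

Section SemidirectProduct.
Variables (V : groupType) (tau : grp_morphism V V).

Definition semi2 of involutive tau := (V * bool)%type.
Hypothesis tauK : involutive tau.
Local Notation S := (semi2 tauK).
HB.instance Definition _ := Choice.on S.

Definition semi2_twist (c : bool) (v : V) : V := if c then tau v else v.
Definition semi2_one : S := (1, false).
Definition semi2_mul (x y : S) : S := (x.1 * semi2_twist x.2 y.1, x.2 (+) y.2).
Definition semi2_inv (x : S) : S := (semi2_twist x.2 x.1^-1, x.2).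

Fact semi2_mulA : associative semi2_mul.
Proof.
case=> [x a] [y b] [z c]; rewrite /semi2_mul /= addbA; congr (_, _).
by case: a; case: b => /=; rewrite ?gmulfM ?tauK ?mulgA.
Qed.
Fact semi2_mul1 : left_id semi2_one semi2_mul.
Proof. by case=> x a; rewrite /semi2_mul /= mul1g. Qed.
Fact semi2_mulr1 : right_id semi2_one semi2_mul.
Proof.
by case=> x a; rewrite /semi2_mul /= addbF; case: a; rewrite /= ?gmulf1 mulg1.
Qed.
Fact semi2_mulV : left_inverse semi2_one semi2_inv semi2_mul.
Proof.
case=> x a; rewrite /semi2_mul /= addbb; case: a; rewrite /= -?gmulfM mulVg //.
by rewrite gmulf1.
Qed.
Fact semi2_mulrV : right_inverse semi2_one semi2_inv semi2_mul.
Proof.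
case=> x a; rewrite /semi2_mul /= addbb; case: a; rewrite /= ?tauK mulgV //.
Qed.
HB.instance Definition _ := isGroup.Build S
  semi2_mulA semi2_mul1 semi2_mulr1 semi2_mulV semi2_mulrV.

Lemma semi2_mulE (x y : S) : x * y = (x.1 * semi2_twist x.2 y.1, x.2 (+) y.2).
Proof. by []. Qed.

Lemma semi2_expg (v : V) j : ((v, false) : S) ^+ j = (v ^+ j, false).
Proof. by elim: j => // j IH; rewrite !expgS IH semi2_mulE. Qed.

End SemidirectProduct.

(** * The group J and the von Dyck group *)

Definition gen3 (G : Type) (x y z : G) (i : 'I_3) : G :=
  if val i == 0%N then x else if val i == 1%N then y else z.

Lemma gen3E (G : Type) (x y z : G) :
  (gen3 x y z (inord 0) = x) * (gen3 x y z (inord 1) = y) *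
  (gen3 x y z (inord 2) = z).
Proof. by rewrite /gen3 /= !inordK. Qed.

Lemma ord3P (P : 'I_3 -> Prop) :
  P (inord 0) -> P (inord 1) -> P (inord 2) -> forall i, P i.
Proof.
by move=> P0 P1 P2 i; rewrite -(inord_val i); case: i => -[|[|[|]]].
Qed.

Lemma mulg1C (G : groupType) (x y : G) : x * y = 1 -> y * x = 1.
Proof. by move/mulg1_eq<-; rewrite mulVg. Qed.

Lemma expgn_conj (G : groupType) (x y : G) j :
  (y^-1 * x * y) ^+ j = y^-1 * x ^+ j * y.
Proof. by rewrite -!mulgA -!conjgE conjXg. Qed.

Section JUniversal.
Variables k n m : nat.
Local Notation J := (J k n m).
Local Notation s := (Js k n m).
Local Notation t := (Jt k n m).
Local Notation u := (Ju k n m).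

(** Universal property of the presentation. The sigma type lets the morphism serve as data in the
    constructions of [J_to_VD] and [J_to_tri]. *)
Lemma J_hom (G : groupType) (x y z : G) :
    x ^+ k = 1 -> y ^+ n = 1 -> z ^+ m = 1 ->
    x * y * z = y * z * x -> y * z * x = z * x * y ->
  {f : grp_morphism J G | [/\ f s = x, f t = y & f u = z]}.
Proof.
move=> xk yn zm e1 e2.
have H : {in J_rels k n m, forall r,
    word_eval (gen3 x y z) r.1 = word_eval (gen3 x y z) r.2}.
  move=> r; rewrite !inE => /or4P[/eqP->|/eqP->|/eqP->|/orP[]/eqP->] /=;
  by rewrite ?word_eval_nseq ?word_eval_letter ?word_eval0 ?gen3E ?mulg1 ?mulgA.
exists (pres_hom H : grp_morphism (presented_group _) _).
by split; rewrite /= pres_hom_gen gen3E.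
Qed.

Lemma J_ind (Q : J -> Prop) : Q 1 ->
  (forall g, Q g -> Q (s * g)) -> (forall g, Q g -> Q (t * g)) ->
  (forall g, Q g -> Q (u * g)) -> (forall g, Q g -> Q (s^-1 * g)) ->
  (forall g, Q g -> Q (t^-1 * g)) -> (forall g, Q g -> Q (u^-1 * g)) ->
  forall g, Q g.
Proof.
move=> Q1 Qs Qt Qu Qs' Qt' Qu'.
by apply: presented_ind => //; apply: ord3P.
Qed.

Lemma J_sk : s ^+ k = 1.
Proof.
have := @presented_rel _ (J_rels k n m) (nseq k (letter (inord 0)), [::]).
by rewrite !inE eqxx /= !class_of_wordE word_eval0 word_eval_nseq; apply.
Qed.
Lemma J_tn : t ^+ n = 1.
Proof.
have := @presented_rel _ (J_rels k n m) (nseq n (letter (inord 1)), [::]).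
by rewrite !inE eqxx ?orbT /= !class_of_wordE word_eval0 word_eval_nseq; apply.
Qed.
Lemma J_um : u ^+ m = 1.
Proof.
have := @presented_rel _ (J_rels k n m) (nseq m (letter (inord 2)), [::]).
by rewrite !inE eqxx ?orbT /= !class_of_wordE word_eval0 word_eval_nseq; apply.
Qed.
Lemma J_stu : s * t * u = t * u * s.
Proof.
have := @presented_rel _ (J_rels k n m) ([:: letter (inord 0); letter (inord 1);
  letter (inord 2)], [:: letter (inord 1); letter (inord 2); letter (inord 0)]).
rewrite !inE eqxx ?orbT /= !class_of_wordE !word_eval_letter !word_eval0 !mulg1.
by rewrite !mulgA; apply.
Qed.
Lemma J_tus : t * u * s = u * s * t.
Proof.
have := @presented_rel _ (J_rels k n m) ([:: letter (inord 1); letter (inord 2);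
  letter (inord 0)], [:: letter (inord 2); letter (inord 0); letter (inord 1)]).
rewrite !inE eqxx ?orbT /= !class_of_wordE !word_eval_letter !word_eval0 !mulg1.
by rewrite !mulgA; apply.
Qed.

Definition Jzeta : J := s * t * u.

Local Notation zeta := Jzeta.
(** The relations say that the three cyclic rotations of [stu] are equal, and a rotation moves one
    generator from one end of the word to the other. *)
Lemma Jzeta_central g : commute zeta g.
Proof.
have zs : commute zeta s by rewrite /commute /Jzeta {2}J_stu -!mulgA.
have zt : commute zeta t by rewrite /commute /Jzeta !J_stu {2}J_tus -!mulgA.
have zu : commute zeta u by rewrite /commute /Jzeta {1}J_stu J_tus -!mulgA.
elim/J_ind: g => [|g|g|g|g|g|g]; first exact: commute1.
- exact: commuteM.
- exact: commuteM.
- exact: commuteM.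
- exact: commuteM (commuteV _).
- exact: commuteM (commuteV _).
- exact: commuteM (commuteV _).
Qed.

End JUniversal.

Section VonDyck.
Variables k n m : nat.
Local Notation J := (J k n m).
Local Notation zeta := (Jzeta k n m).

(** Keeping the relations of J in the list makes [stu = 1] the only new rule in a derivation. *)
Definition VD_rels : seq (word 'I_3 * word 'I_3) :=
  ([:: letter (inord 0); letter (inord 1); letter (inord 2)], [::])
  :: J_rels k n m.
Definition VD := presented_group VD_rels.
HB.instance Definition _ := Group.on VD.

Definition VDs : VD := pres_gen VD_rels (inord 0).
Definition VDt : VD := pres_gen VD_rels (inord 1).
Definition VDu : VD := pres_gen VD_rels (inord 2).

Lemma VD_stu : VDs * VDt * VDu = 1.
Proof.
have := @presented_rel _ VD_rels ([:: letter (inord 0); letter (inord 1);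
  letter (inord 2)], [::]).
rewrite !inE eqxx ?orbT /= !class_of_wordE !word_eval_letter !word_eval0 !mulg1.
by rewrite !mulgA; apply.
Qed.
Lemma VD_sk : VDs ^+ k = 1.
Proof.
have := @presented_rel _ VD_rels (nseq k (letter (inord 0)), [::]).
by rewrite !inE eqxx ?orbT /= !class_of_wordE word_eval0 word_eval_nseq; apply.
Qed.
Lemma VD_tn : VDt ^+ n = 1.
Proof.
have := @presented_rel _ VD_rels (nseq n (letter (inord 1)), [::]).
by rewrite !inE eqxx ?orbT /= !class_of_wordE word_eval0 word_eval_nseq; apply.
Qed.
Lemma VD_um : VDu ^+ m = 1.
Proof.
have := @presented_rel _ VD_rels (nseq m (letter (inord 2)), [::]).
by rewrite !inE eqxx ?orbT /= !class_of_wordE word_eval0 word_eval_nseq; apply.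
Qed.

Lemma VD_hom (G : groupType) (x y z : G) :
    x ^+ k = 1 -> y ^+ n = 1 -> z ^+ m = 1 -> x * y * z = 1 ->
  {f : grp_morphism VD G | [/\ f VDs = x, f VDt = y & f VDu = z]}.
Proof.
move=> xk yn zm e.
have e1 : y * z * x = 1 by apply: mulg1C; rewrite mulgA.
have e2 : z * x * y = 1 by rewrite -mulgA; apply: mulg1C.
have H : {in VD_rels, forall r,
    word_eval (gen3 x y z) r.1 = word_eval (gen3 x y z) r.2}.
  move=> r; rewrite !inE => /or4P[/eqP->|/eqP->|/eqP->|/or3P[]/eqP->] /=;
  by rewrite ?word_eval_nseq ?word_eval_letter ?word_eval0 ?gen3E ?mulg1 ?mulgA
    ?e ?e1 ?e2.
exists (pres_hom H : grp_morphism (presented_group _) _).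
by split; rewrite /= pres_hom_gen gen3E.
Qed.

Lemma VD_hom_eq (G : groupType) (f g : grp_morphism VD G) :
  f VDs = g VDs -> f VDt = g VDt -> f VDu = g VDu -> f =1 g.
Proof.
move=> es et eu; apply: presented_ind; first by rewrite !gmulf1.
  by move=> i x IH; rewrite !gmulfM IH; congr (_ * _); move: i; apply: ord3P.
move=> i x IH; rewrite !gmulfM IH !gmulfV; congr (_^-1 * _).
by move: i; apply: ord3P.
Qed.

(** Induction on the derivation: only the new relation changes the class in J, and it does so by the
    central factor [zeta]. Two natural exponents, one on each side, stand for an integer exponent;
    the same convention is used below. *)
Lemma VD_word_eq (w1 w2 : word 'I_3) : word_eq VD_rels w1 w2 ->
  exists i j, zeta ^+ i * class_of_word (J_rels k n m) w1 =
              zeta ^+ j * class_of_word (J_rels k n m) w2.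
Proof.
elim=> {w1 w2}.
- by exists 0%N, 0%N.
- by move=> w1 w2 _ [i [j e]]; exists j, i.
- move=> w1 w2 w3 _ [i [j e]] _ [i' [j' e']]; exists (i' + i)%N, (j + j')%N.
  by rewrite !expgnDr -!mulgA e -e' !mulgA -!expgnDr addnC.
- move=> w1 w1' w2 w2' _ [i [j e]] _ [i' [j' e']].
  exists (i' + i)%N, (j' + j)%N; rewrite !class_of_word_cat !expgnDr -!mulgA.
  rewrite (mulgA _ _ (class_of_word _ w2)) e (mulgA _ _ (class_of_word _ w2')).
  rewrite !mulgA.
  have c1 w : commute (zeta ^+ i') (zeta ^+ j * w).
    apply: commute_sym; apply: commuteX; apply: commute_sym; exact: Jzeta_central.
  rewrite -(mulgA _ _ (class_of_word _ w1')) c1 -!mulgA e'.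
  rewrite (mulgA (zeta ^+ j)) (mulgA (zeta ^+ j')) !mulgA; congr (_ * _).
  have c2 : commute (zeta ^+ j') (zeta ^+ j * class_of_word _ w1').
    apply: commute_sym; apply: commuteX; apply: commute_sym; exact: Jzeta_central.
  by rewrite -[RHS]mulgA c2.
- move=> a; exists 0%N, 0%N; congr (_ * _).
  by apply/class_of_word_eq/word_eq_cancel.
move=> r; rewrite in_cons => /predU1P[->|rr] /=.
  exists 0%N, 1%N; rewrite expg0 mul1g expg1 mulg1.
  by rewrite class_of_wordE !word_eval_letter word_eval0 mulg1 mulgA.
by exists 0%N, 0%N; rewrite (presented_rel rr).
Qed.

Lemma J_to_VD : {f : grp_morphism J VD |
  [/\ f (Js k n m) = VDs, f (Jt k n m) = VDt & f (Ju k n m) = VDu]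
  & forall g, f g = 1 -> exists i j, zeta ^+ i * g = zeta ^+ j}.
Proof.
have e1 : VDt * VDu * VDs = 1 by apply: mulg1C; rewrite mulgA VD_stu.
have e2 : VDu * VDs * VDt = 1 by rewrite -mulgA; apply: mulg1C; exact: VD_stu.
have [|| f [fs ft fu]] := J_hom VD_sk VD_tn VD_um; rewrite ?VD_stu ?e1 ?e2 //.
(* The image of [g] is the class of the word representing [g], read in the von Dyck group, so
   [VD_word_eq] applies. *)
exists f => // g; suff -> : f g = class_of_word VD_rels (repr g).
  move/class_of_word_eq/VD_word_eq => [i [j]]; rewrite class_of_repr mulg1.
  by exists i, j.
rewrite -{1}(class_of_repr g); elim: (repr g) => [|[i c] w IH].
  exact: gmulf1.
rewrite -cat1s !class_of_word_cat gmulfM IH; congr (_ * _).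
rewrite !class_of_word_letter /=.
have e : f (pres_gen _ i) = pres_gen VD_rels i by move: i; apply: ord3P.
by case: c; rewrite ?gmulfV e.
Qed.

End VonDyck.

(** * The von Dyck group inside the triangle group *)

Section TriangleUniversal.
Variables k n m : nat.
Local Notation T := (triangle_group k n m).
Local Notation r i := (tri_gen k n m (inord i)).
Local Notation V := (VD k n m).
Local Notation vs := (VDs k n m).
Local Notation vt := (VDt k n m).
Local Notation vu := (VDu k n m).

Lemma tri_hom (G : groupType) (x y z : G) :
    x * x = 1 -> y * y = 1 -> z * z = 1 ->
    (x * y) ^+ k = 1 -> (x * z) ^+ n = 1 -> (y * z) ^+ m = 1 ->
  {f : grp_morphism T G | [/\ f (r 0) = x, f (r 1) = y & f (r 2) = z]}.
Proof.
move=> xx yy zz xy xz yz.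
have H : {in triangle_rels k n m, forall r,
    word_eval (gen3 x y z) r.1 = word_eval (gen3 x y z) r.2}.
  move=> w; rewrite !inE => /or4P[/eqP->|/eqP->|/eqP->|/or3P[]/eqP->] /=;
  by rewrite ?word_eval_flatten ?word_eval_letter ?word_eval0 ?gen3E ?mulg1 ?mulgA.
exists (pres_hom H : grp_morphism (presented_group _) _).
by split; rewrite /= pres_hom_gen gen3E.
Qed.

Lemma tri_gen_sqr i : tri_gen k n m i * tri_gen k n m i = 1.
Proof.
rewrite {2}(tri_gen_word _ _ _ i true) class_of_word_letter /=.
exact: mulgV.
Qed.

Lemma tri_genV i : (tri_gen k n m i)^-1 = tri_gen k n m i.
Proof. exact/mulg1_eq/tri_gen_sqr. Qed.

Lemma tri_rel01 : (r 0 * r 1) ^+ k = 1.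
Proof.
have := @presented_rel _ (triangle_rels k n m)
  (flatten (nseq k [:: letter (inord 0); letter (inord 1)]), [::]).
rewrite !inE eqxx ?orbT /= !class_of_wordE word_eval_flatten !word_eval_letter.
by rewrite word_eval0 mulg1; apply.
Qed.
Lemma tri_rel02 : (r 0 * r 2) ^+ n = 1.
Proof.
have := @presented_rel _ (triangle_rels k n m)
  (flatten (nseq n [:: letter (inord 0); letter (inord 2)]), [::]).
rewrite !inE eqxx ?orbT /= !class_of_wordE word_eval_flatten !word_eval_letter.
by rewrite word_eval0 mulg1; apply.
Qed.
Lemma tri_rel12 : (r 1 * r 2) ^+ m = 1.
Proof.
have := @presented_rel _ (triangle_rels k n m)
  (flatten (nseq m [:: letter (inord 1); letter (inord 2)]), [::]).
rewrite !inE eqxx ?orbT /= !class_of_wordE word_eval_flatten !word_eval_letter.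
by rewrite word_eval0 mulg1; apply.
Qed.

Lemma expgn_swap i j d :
  (tri_gen k n m i * tri_gen k n m j) ^+ d = 1 ->
  (tri_gen k n m j * tri_gen k n m i) ^+ d = 1.
Proof.
move=> e; have : ((tri_gen k n m i * tri_gen k n m j)^-1) ^+ d = 1.
  by rewrite expVgn e invg1.
by rewrite invgM !tri_genV.
Qed.

Definition VD_to_tri : {f : grp_morphism V T |
  [/\ f vs = r 1 * r 0, f vt = r 0 * r 2 & f vu = r 2 * r 1]}.
Proof.
apply: VD_hom; rewrite ?(expgn_swap tri_rel01) ?tri_rel02 ?(expgn_swap tri_rel12) //.
by rewrite !mulgA -(mulgA (r 1)) tri_gen_sqr mulg1 -(mulgA (r 1)) tri_gen_sqr
  mulg1 tri_gen_sqr.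
Qed.

(** This is conjugation by [r 0] as seen inside the von Dyck group. The relation [stu = 1] forces
    the image of [vu] to be [vt * vs]. *)
Lemma VD_involution : {tau : grp_morphism V V |
  involutive tau & tau vs = vs^-1 /\ tau vt = vt^-1}.
Proof.
have e1 : vt * vu * vs = 1 by apply: mulg1C; rewrite mulgA VD_stu.
have [|||| tau [es et eu]] := @VD_hom k n m V vs^-1 vt^-1 (vt * vs).
- by rewrite expVgn VD_sk invg1.
- by rewrite expVgn VD_tn invg1.
(* [vt * vs] is conjugate to [vs * vt], the inverse of [vu], hence is killed by the exponent [m]. *)
- have -> : vt * vs = vs^-1 * vu^-1 * vs.
    by rewrite -(mulg1_eq (VD_stu k n m)) invgK -!mulgA mulKg.
  by rewrite expgn_conj expVgn VD_um invg1 mulg1 mulVg.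
- by rewrite -!mulgA mulKg mulVg.
exists tau => // x; pose f : grp_morphism V V := tau \o tau.
have := @VD_hom_eq k n m V f idfun; apply => /=.
- by rewrite es gmulfV es invgK.
- by rewrite et gmulfV et invgK.
- by rewrite eu gmulfM es et -invgM -(mulg1_eq (VD_stu k n m)).
Qed.

(* The triangle group maps to the extension of the von Dyck group by the
   involution inverting s and t, so no relation is added to the von Dyck group. *)
Lemma VD_to_tri_inj : injective (sval VD_to_tri).
Proof.
apply: gmulf_inj => v; case: VD_to_tri => f [fs ft fu] /= fv.
have [tau tauK [es et]] := VD_involution.
pose S := semi2 tauK.
(* Once [r 0] goes to the involution, the other two images are forced by [r 1 = s (r 0)] and
   [r 2 = t^-1 (r 0)]. *)
have [|||||| g [g0 g1 g2]] := @tri_hom S (1, true) (vs, true) (vt^-1, true).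
- by rewrite semi2_mulE /= gmulf1 mulg1.
- by rewrite semi2_mulE /= es mulgV.
- by rewrite semi2_mulE /= gmulfV et invgK mulVg.
- by rewrite semi2_mulE /= mul1g es semi2_expg expVgn VD_sk invg1.
- by rewrite semi2_mulE /= mul1g gmulfV et invgK semi2_expg VD_tn.
- rewrite semi2_mulE /= gmulfV et invgK semi2_expg.
  have -> : vs * vt = vu^-1.
    by rewrite -(mulg1_eq (VD_stu k n m)) invgK.
  by rewrite expVgn VD_um invg1.
pose h (v : V) : S := (v, false).
have hM : monoid_morphism h by split.
pose hm := isUMagmaMorphism.Build V S h hM.
pose h' : grp_morphism V S := HB.pack h hm.
pose gf : grp_morphism V S := g \o f.
have e : gf =1 h'.
  apply: VD_hom_eq; rewrite /= ?fs ?ft ?fu gmulfM ?g0 ?g1 ?g2 semi2_mulE /=.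
  - by rewrite gmulf1 mulg1.
  - by rewrite mul1g gmulfV et invgK.
  - by rewrite es -invgM (mulg1_eq (VD_stu k n m)).
by move: (e v); rewrite /= fv gmulf1 => /(congr1 fst) /= <-.
Qed.

End TriangleUniversal.

(** * The subgroup W and the central element *)

Lemma subgroup1 (G : groupType) (H : subgroup G) : subgroup_set H 1.
Proof. by case: (subgroupP H). Qed.
Lemma subgroupM (G : groupType) (H : subgroup G) x y :
  subgroup_set H x -> subgroup_set H y -> subgroup_set H (x * y).
Proof. by case: (subgroupP H) => _ M _; apply: M. Qed.
Lemma subgroupV (G : groupType) (H : subgroup G) x :
  subgroup_set H x -> subgroup_set H x^-1.
Proof. by case: (subgroupP H) => _ _ V; apply: V. Qed.
Lemma subgroupX (G : groupType) (H : subgroup G) x j :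
  subgroup_set H x -> subgroup_set H (x ^+ j).
Proof.
by move=> Hx; elim: j => [|j IH]; rewrite ?expgS; [apply: subgroup1|apply: subgroupM].
Qed.

(** The equation says that [y] is the integer power of [x] with exponent [j - i]. *)
Lemma cyclic_subgroupP (G : groupType) (x y : G) :
  subgroup_set (cyclic_subgroup x) y <-> exists i j, x ^+ i * y = x ^+ j.
Proof.
split=> [|[i [j e]]]; last first.
  have Cx : subgroup_set (cyclic_subgroup x) x by move=> B [_]; apply.
  rewrite -(mulKg (x ^+ i) y) e; apply: subgroupM; last exact: subgroupX.
  exact/subgroupV/subgroupX.
move/(_ [set y | exists i j, x ^+ i * y = x ^+ j]); apply; split; last first.
  by move=> _ ->; exists 0%N, 1%N; rewrite mul1g.
have cX i j : commute (x ^+ i) (x ^+ j).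
  by apply: commuteX2; apply: commute_refl.
split=> [|y1 y2 [i [j e]] [i' [j' e']]|y1 [i [j e]]].
- by exists 0%N, 0%N; rewrite mulg1.
- exists (i' + i)%N, (j + j')%N.
  by rewrite !expgnDr -!mulgA (mulgA (x ^+ i)) e mulgA cX -mulgA e'.
- exists j, i; rewrite -e -mulgA mulgV mulg1 //.
Qed.

Lemma normal_closure_ker (G H : groupType) (f : grp_morphism G H) (A : set G) :
  (forall x, A x -> f x = 1) -> forall x, subgroup_set (normal_closure A) x -> f x = 1.
Proof.
move=> fA x /(_ [set x | f x = 1]); apply; split=> //; split; first split.
- exact: gmulf1.
- by move=> a b /= fa fb; rewrite gmulfM fa fb mulg1.
- by move=> a /= fa; rewrite gmulfV fa invg1.
- by move=> a g /= fa; rewrite !gmulfM fa mulg1 gmulfV mulgV.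
Qed.

Definition Zp_gen d : 'I_d.+1 := inZp 1.

Lemma Zp_gen_expg d i : Zp_gen d ^+ i = inZp i.
Proof.
rewrite Zp_expg; apply: val_inj => /=.
by rewrite modnMml mul1n.
Qed.

Lemma Zp_gen_expg_eq d i j : Zp_gen d ^+ i = Zp_gen d ^+ j -> i = j %[mod d.+1].
Proof. by rewrite !Zp_gen_expg => /(congr1 val). Qed.

Lemma Zp_gen_expg1 d i : d.+1 %| i -> Zp_gen d ^+ i = 1.
Proof. by move=> di; rewrite Zp_gen_expg; apply: val_inj; apply/eqP. Qed.

Section WExact.
Variables k b n c m : nat.
Hypotheses (n_gt0 : 0 < n) (m_gt0 : 0 < m) (coprime_nm : coprime n m).
Local Notation J := (J k (b * n) (c * m)).
Local Notation s := (Js k (b * n) (c * m)).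
Local Notation t := (Jt k (b * n) (c * m)).
Local Notation u := (Ju k (b * n) (c * m)).
Local Notation zeta := (Jzeta k (b * n) (c * m)).
Local Notation T := (triangle_group k (b * n) (c * m)).
Local Notation r i := (tri_gen k (b * n) (c * m) (inord i)).
Local Notation WJ := (subgroup_set (W_subgroup k b n c m)).
Local Notation W := (W k b n c m).
Local Notation Wp := (Wplus k (b * n) (c * m)).

Lemma W_s : WJ s.
Proof. by apply: sub_gen_smallest; left; left. Qed.
Lemma W_tn : WJ (t ^+ n).
Proof. by apply: sub_gen_smallest; left; right. Qed.
Lemma W_um : WJ (u ^+ m).
Proof. by apply: sub_gen_smallest; right. Qed.
Lemma W_conj g x : WJ x -> WJ (g * x * g^-1).
Proof. by case: (smallest_is_normal [set s; t ^+ n; u ^+ m]) => _; apply. Qed.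

Lemma commute_stu : commute (s * t) u.
Proof. by rewrite /commute J_stu J_tus !mulgA. Qed.

Lemma zeta_expg j : zeta ^+ j = (s * t) ^+ j * u ^+ j.
Proof. by rewrite expgMn //; apply: commute_stu. Qed.

(** Sending [t] to a generator of Z/n and [s], [u] to the identity kills the three normal generators
    of W, while [zeta] goes to that generator. *)
Lemma W_zeta_modn i j g : WJ g -> zeta ^+ i * g = zeta ^+ j -> i = j %[mod n].
Proof.
move=> Wg; have [d nE] : exists d, n = d.+1 by exists n.-1; rewrite prednK.
have Zd : Zp_gen d ^+ (b * n) = 1 by rewrite Zp_gen_expg1 // nE dvdn_mull.
have [| | f [fs ft fu]] :=
  J_hom (expg1n _ k) Zd (expg1n _ (c * m)).
- by rewrite !mulg1 mul1g.
- by rewrite !mulg1 mul1g.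
have fg : f g = 1.
  apply: normal_closure_ker Wg => x [[]|] -> //; rewrite gmulfXn ?ft ?fu ?expg1n //.
  by rewrite Zp_gen_expg1 // nE.
move/(congr1 f); rewrite gmulfM fg !gmulfXn !gmulfM fs ft fu !mulg1 mul1g nE.
exact: Zp_gen_expg_eq.
Qed.

(** The same argument, with [u] sent to a generator of Z/m. *)
Lemma W_zeta_modm i j g : WJ g -> zeta ^+ i * g = zeta ^+ j -> i = j %[mod m].
Proof.
move=> Wg; have [d mE] : exists d, m = d.+1 by exists m.-1; rewrite prednK.
have Zd : Zp_gen d ^+ (c * m) = 1 by rewrite Zp_gen_expg1 // mE dvdn_mull.
have [| | f [fs ft fu]] :=
  J_hom (expg1n _ k) (expg1n _ (b * n)) Zd.
- by rewrite !mulg1 !mul1g.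
- by rewrite !mulg1 !mul1g.
have fg : f g = 1.
  apply: normal_closure_ker Wg => x [[]|] -> //; rewrite gmulfXn ?ft ?fu ?expg1n //.
  by rewrite Zp_gen_expg1 // mE.
move/(congr1 f); rewrite gmulfM fg !gmulfXn !gmulfM fs ft fu !mulg1 !mul1g mE.
exact: Zp_gen_expg_eq.
Qed.

Lemma W_zeta_mod i j g : WJ g -> zeta ^+ i * g = zeta ^+ j -> i = j %[mod n * m].
Proof.
move=> Wg e; apply/eqP; rewrite chinese_remainder //.
by rewrite (W_zeta_modn Wg e) (W_zeta_modm Wg e) !eqxx.
Qed.

(** The product of the conjugates [t^(i-1) s t^(1-i)] telescopes to [(st)^n t^-n], and [y] cancels
    the last factor. Since [st] commutes with [u], the powers [(st)^(nm)] and [u^(nm)] combine into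
    a power of [stu]. *)
Lemma val_W_Delta : subgroup_incl (W_subgroup k b n c m) (W_Delta k b n c m) = zeta ^+ (n * m).
Proof.
rewrite /W_Delta gmulfM !gmulfXn gmulfM gmulf_prod /=.
have [-> ->] : subgroup_incl (W_subgroup k b n c m) (W_y k b n c m) = t ^+ n /\
  subgroup_incl (W_subgroup k b n c m) (W_z k b n c m) = u ^+ m by [].
have -> d : \prod_(1 <= i < d.+1) subgroup_incl (W_subgroup k b n c m) (W_x k b n c m i)
  = (s * t) ^+ d * t ^- d.
  elim: d => [|d IH]; first by rewrite big_geq // !expg0 mulgV.
  rewrite big_nat_recr //= IH.
  rewrite -[subgroup_incl (W_subgroup k b n c m) _]/(t ^+ d * s * t ^- d).
  by rewrite !mulgA mulgVK !expgSr invgM !mulgA mulgK.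
by rewrite mulgVK -!expgnA (mulnC m n) -zeta_expg.
Qed.

Lemma W_st_expg j : exists2 w, WJ w & (s * t) ^+ j = w * t ^+ j.
Proof.
elim: j => [|j [w Ww e]]; first by exists 1; rewrite ?mulg1 //; exact: subgroup1.
exists (s * (t * w * t^-1)).
  by apply: subgroupM; [exact: W_s|exact: W_conj].
by rewrite expgS e expgS !mulgA mulgVK.
Qed.

Lemma W_t_dvd j : n %| j -> WJ (t ^+ j).
Proof.
by case/dvdnP=> q ->; rewrite (mulnC q) expgnA; apply: subgroupX; exact: W_tn.
Qed.
Lemma W_u_dvd j : m %| j -> WJ (u ^+ j).
Proof.
by case/dvdnP=> q ->; rewrite (mulnC q) expgnA; apply: subgroupX; exact: W_um.
Qed.

Lemma zeta_expgC i x : x * zeta ^+ i = zeta ^+ i * x.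
Proof. exact/commuteX/commute_sym/Jzeta_central. Qed.

Lemma dvdn_chinese (p q : nat) : 0 < p -> 0 < q -> coprime p q ->
  exists2 j, p %| j & q %| j.+1.
Proof.
(* The residue [q.-1] represents -1 modulo [q]. *)
move=> p_gt0 q_gt0 pq; exists (chinese p q 0 q.-1).
  by rewrite /dvdn chinese_modl // mod0n.
by rewrite /dvdn -addn1 -modnDml chinese_modr // modnDml addn1 prednK // modnn.
Qed.

(** Membership in the product of W and the subgroup generated by [zeta], with an integer exponent
    again split over both sides. *)
Definition W_zeta_coset (g : J) := exists w i j, WJ w /\ zeta ^+ i * g = zeta ^+ j * w.

Lemma W_zeta_cosetM g h : W_zeta_coset g -> W_zeta_coset h -> W_zeta_coset (g * h).
Proof.
move=> [w [i [j [Ww e]]]] [w' [i' [j' [Ww' e']]]].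
exists (w * w'), (i' + i)%N, (j + j')%N; split; first exact: subgroupM.
rewrite !expgnDr -!mulgA (mulgA (zeta ^+ i)) e (mulgA (zeta ^+ j') w).
rewrite -(zeta_expgC j' w) -(mulgA w) -e' (mulgA (zeta ^+ i')).
by rewrite -(zeta_expgC i' (_ * w)) !mulgA.
Qed.

Lemma W_zeta_cosetV g : W_zeta_coset g -> W_zeta_coset g^-1.
Proof.
move=> [w [i [j [Ww e]]]]; exists w^-1, j, i; split; first exact: subgroupV.
apply: (mulIg g); rewrite mulgVK -(zeta_expgC i) -mulgA e.
by rewrite -zeta_expgC mulKg.
Qed.

Lemma W_zeta_cover g : W_zeta_coset g.
Proof.
have cs : W_zeta_coset s by exists s, 0%N, 0%N; split; first exact: W_s.
have ct : W_zeta_coset t.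
  (* With [n] dividing [j] and [m] dividing [j.+1], the first factor of
     [zeta^(j+1) = u^(j+1) (st)^(j+1)] lies in W, and the second is [t^(j+1)], hence [t], modulo
     W. *)
  have [j nj mj] := dvdn_chinese n_gt0 m_gt0 coprime_nm.
  have [w Ww e] := W_st_expg j.+1.
  exists (t ^- j * w^-1 * u ^- j.+1), 0%N, j.+1; split.
    apply: subgroupM; [apply: subgroupM|]; apply: subgroupV => //.
      exact: W_t_dvd.
    exact: W_u_dvd.
  rewrite mul1g -zeta_expgC zeta_expg (commuteX2 _ _ commute_stu) e.
  by rewrite !mulgA mulgVK mulgVK expgSr mulKg.
have cu : W_zeta_coset u.
  (* With the divisibilities exchanged, [(st)^(j+1)] lies in W and [u^(j+1)] is [u] modulo W. *)
  have [|j mj nj] := dvdn_chinese m_gt0 n_gt0; first by rewrite coprime_sym.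
  have [w Ww e] := W_st_expg j.+1.
  exists (u ^- j * t ^- j.+1 * w^-1), 0%N, j.+1; split.
    apply: subgroupM; [apply: subgroupM|]; apply: subgroupV => //.
      exact: W_u_dvd.
    exact: W_t_dvd.
  rewrite mul1g -zeta_expgC zeta_expg e.
  by rewrite !mulgA !mulgVK expgSr mulKg.
elim/J_ind: g => [|g|g|g|g|g|g].
- exists 1, 0%N, 0%N; split=> //; exact: subgroup1.
1-3: exact: W_zeta_cosetM.
all: by apply: W_zeta_cosetM; apply: W_zeta_cosetV.
Qed.

End WExact.

(** * The exact sequence *)

Section JToTriangle.
Variables k n m : nat.
Local Notation J := (J k n m).
Local Notation zeta := (Jzeta k n m).
Local Notation T := (triangle_group k n m).
Local Notation r i := (tri_gen k n m (inord i)).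

(** Composite of the quotient by [zeta] with the embedding of the von Dyck group; injectivity of the
    latter makes the kernel exactly the powers of [zeta]. *)
Lemma J_to_tri : {f : grp_morphism J T |
  [/\ f (Js k n m) = r 1 * r 0, f (Jt k n m) = r 0 * r 2 & f (Ju k n m) = r 2 * r 1]
  & forall g, f g = 1 <-> exists i j, zeta ^+ i * g = zeta ^+ j}.
Proof.
have := @VD_to_tri_inj k n m; case: (VD_to_tri k n m) => f [fs ft fu] /= f_inj.
have [g [gs gt gu] g_ker] := J_to_VD k n m.
pose h : grp_morphism J T := f \o g.
have h1 : h zeta = 1 by rewrite /= /Jzeta !gmulfM gs gt gu -!gmulfM VD_stu gmulf1.
exists h => [|x]; first by rewrite /= gs gt gu.
split=> [/= e|[i [j /(congr1 h)]]].
  by apply: g_ker; apply: f_inj; rewrite e gmulf1.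
by rewrite gmulfM !gmulfXn h1 !expg1n mul1g.
Qed.

Lemma odd_tri_lengthM (x y : T) :
  odd (tri_length (x * y)) = odd (tri_length x) (+) odd (tri_length y).
Proof.
have [v ->] := tri_prodP x; have [v' ->] := tri_prodP y.
by rewrite -big_cat -/(tri_prod _ _ _ _) !odd_tri_length size_cat oddD.
Qed.

Lemma tri_prod_seq1 i : tri_prod k n m [:: i] = tri_gen k n m i.
Proof. by rewrite /tri_prod big_seq1. Qed.

Lemma odd_tri_length_gen i : odd (tri_length (tri_gen k n m i)).
Proof. by rewrite -tri_prod_seq1 odd_tri_length. Qed.

Variable f : grp_morphism J T.
Hypotheses (fs : f (Js k n m) = r 1 * r 0) (ft : f (Jt k n m) = r 0 * r 2)
           (fu : f (Ju k n m) = r 2 * r 1).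

Lemma J_to_tri_even g : subgroup_set (alternating_subgroup k n m) (f g).
Proof.
have E1 : subgroup_set (alternating_subgroup k n m) 1 := subgroup1 _.
have Es : subgroup_set (alternating_subgroup k n m) (f (Js k n m)).
  by rewrite fs /= odd_tri_lengthM !odd_tri_length_gen.
have Et : subgroup_set (alternating_subgroup k n m) (f (Jt k n m)).
  by rewrite ft /= odd_tri_lengthM !odd_tri_length_gen.
have Eu : subgroup_set (alternating_subgroup k n m) (f (Ju k n m)).
  by rewrite fu /= odd_tri_lengthM !odd_tri_length_gen.
elim/J_ind: g => [|g|g|g|g|g|g]; rewrite ?gmulf1 ?gmulfM ?gmulfV //;
  apply: subgroupM => //; exact: subgroupV.
Qed.

(** An even word splits into pairs [r_i r_j = (r_i r_0) (r_j r_0)^-1], and the elements [r_i r_0]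
    are the images of 1, [s] and [t^-1]. *)
Lemma J_to_tri_onto x : subgroup_set (alternating_subgroup k n m) x ->
  exists g, f g = x.
Proof.
have f0 i : exists g, f g = tri_gen k n m i * r 0.
  move: i; apply: ord3P.
  - by exists 1; rewrite gmulf1 tri_gen_sqr.
  - by exists (Js k n m).
  - by exists (Jt k n m)^-1; rewrite gmulfV ft invgM !tri_genV.
have f2 i j : exists g, f g = tri_gen k n m i * tri_gen k n m j.
  have [[gi ei] [gj ej]] := (f0 i, f0 j).
  exists (gi * gj^-1); rewrite gmulfM gmulfV ei ej invgM !tri_genV.
  by rewrite !mulgA -(mulgA (tri_gen k n m i)) tri_gen_sqr mulg1.
have [v ->] := tri_prodP x; rewrite /= odd_tri_length.
have [d] := ubnP (size v); elim: d v => // d IH [|i [|j v]] //= sv ev.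
  by exists 1; rewrite gmulf1 /tri_prod big_nil.
have [||g eg] := IH v; first exact: ltnW.
  by rewrite negbK in ev.
have [g' eg'] := f2 i j; exists (g' * g).
by rewrite gmulfM eg eg' /tri_prod !big_cons mulgA.
Qed.

End JToTriangle.

Section WToTriangle.
Variables k b n c m : nat.
Hypotheses (n_gt0 : 0 < n) (m_gt0 : 0 < m) (coprime_nm : coprime n m).
Local Notation J := (J k (b * n) (c * m)).
Local Notation zeta := (Jzeta k (b * n) (c * m)).
Local Notation T := (triangle_group k (b * n) (c * m)).
Local Notation WJ := (W_subgroup k b n c m).
Local Notation W := (W k b n c m).
Local Notation Wp := (Wplus k (b * n) (c * m)).
Local Notation Delta := (W_Delta k b n c m).
Local Notation f := (s2val (J_to_tri k (b * n) (c * m))).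

Lemma W_to_Wplus : {p : grp_morphism W Wp |
  forall w, subgroup_incl _ (p w) = f (subgroup_incl WJ w)}.
Proof.
have fE g : subgroup_set (alternating_subgroup k (b * n) (c * m)) (f g).
  by case: J_to_tri => /= h [hs ht hu] _; apply: J_to_tri_even.
pose p (w : W) : Wp := subgroup_elt (fE (subgroup_incl WJ w)).
have pM : monoid_morphism p.
  split=> [|x y]; apply: val_inj; rewrite /= ?gmulf1 //.
  by rewrite [LHS]/= !gmulfM.
pose pm := isUMagmaMorphism.Build W Wp p pM.
pose q : grp_morphism W Wp := HB.pack p pm.
by exists q.
Qed.

(** By [W_zeta_mod] both exponents of [zeta] have the same remainder modulo [n * m]; it cancels, and
    the quotients become exponents of [Delta]. *)
Lemma W_zeta_Delta (w : W) :
  (exists i j, zeta ^+ i * subgroup_incl WJ w = zeta ^+ j) <->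
  (exists i j, Delta ^+ i * w = Delta ^+ j).
Proof.
split=> [[i [j e]]|[i [j /(congr1 (subgroup_incl WJ))]]]; last first.
  rewrite gmulfM !gmulfXn /= val_W_Delta -!expgnA => e.
  by exists (n * m * i)%N, (n * m * j)%N.
have Ww : subgroup_set WJ (subgroup_incl WJ w) by apply: set_mem; exact: valP.
have := W_zeta_mod n_gt0 m_gt0 coprime_nm Ww e.
set d := (n * m)%N => ij.
exists (i %/ d)%N, (j %/ d)%N; apply: val_inj.
rewrite -[LHS]/(subgroup_incl WJ _) -[RHS]/(subgroup_incl WJ _).
rewrite gmulfM !gmulfXn /= val_W_Delta -!expgnA -/d.
(* Multiplying by the common remainder power restores the exponents [i] and [j]. *)
apply: (mulgI (zeta ^+ (i %% d))).
by rewrite mulgA -!expgnDr {2}ij !(mulnC d) ![(_ %% d + _)%N]addnC -!divn_eq.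
Qed.

End WToTriangle.

(** Everything reduces to showing that central elements of W die in the triangle group: the kernel
    on W is generated by Delta, and Delta is central because it is a power of [zeta]. *)
Lemma W_extension_of_center (k b n c m : nat)
    (n_gt0 : 0 < n) (m_gt0 : 0 < m) (coprime_nm : coprime n m) :
  (forall w : W k b n c m, center (W k b n c m) w ->
     s2val (J_to_tri k (b * n) (c * m)) (subgroup_incl _ w) = 1) ->
  let D : subgroup (W k b n c m) := cyclic_subgroup (W_Delta k b n c m) in
  [/\ exists p : grp_morphism (W k b n c m) (Wplus k (b * n) (c * m)),
        short_exact (subgroup_incl D) p,
      center (W k b n c m) = D :> set (W k b n c m)
    & exists p : grp_morphism (W k b n c m) (Wplus k (b * n) (c * m)),
        central_extension (subgroup_incl D) p].
Proof.
move=> ctr D.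
have [p pE] := W_to_Wplus k b n c m.
have rD : range (subgroup_incl D) = D.
  apply/seteqP; split=> [_ [x _ <-]|x Dx]; first exact/set_mem/valP.
  by exists (subgroup_elt Dx).
have DE w : subgroup_set D w <-> s2val (J_to_tri k (b * n) (c * m)) (subgroup_incl _ w) = 1.
  rewrite cyclic_subgroupP -(W_zeta_Delta n_gt0 m_gt0 coprime_nm).
  by case: J_to_tri => /= f _ ->.
have ex : short_exact (subgroup_incl D) p.
  split; first exact: val_inj.
    rewrite rD; apply/seteqP; split=> w.
      by move/DE; rewrite -pE => e; apply: val_inj.
    by move=> /= pw; apply/DE; rewrite -pE pw.
  apply/seteqP; split=> // x _.
  have : exists g, s2val (J_to_tri k (b * n) (c * m)) g = subgroup_incl _ x.
    case: J_to_tri => /= f [fs ft fu] _; apply: J_to_tri_onto => //.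
    exact/set_mem/valP.
  move=> [g eg].
  (* The preimage [g] in J is corrected by powers of [zeta], which die in the triangle group, to
     obtain a preimage in W. *)
  have [w [i [j [Ww e]]]] := W_zeta_cover n_gt0 m_gt0 coprime_nm g.
  exists (subgroup_elt Ww) => //; apply: val_inj.
  rewrite -[LHS]/(subgroup_incl _ _) pE -[RHS]/(subgroup_incl _ _) -eg.
  have fz : s2val (J_to_tri k (b * n) (c * m)) (Jzeta _ _ _) = 1.
    case: J_to_tri => /= f _ fK; apply/fK; exists 0%N, 1%N; rewrite mul1g //.
  have := congr1 (s2val (J_to_tri k (b * n) (c * m))) e.
  by rewrite !gmulfM !gmulfXn fz !expg1n !mul1g.
have cD : center (W k b n c m) = D.
  apply/seteqP; split=> w; first by move=> cw; apply/DE/ctr.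
  rewrite cyclic_subgroupP => -[i [j e]] y.
  have Dc (x : W k b n c m) : commute x (W_Delta k b n c m).
    apply: val_inj; have := zeta_expgC (n * m) (subgroup_incl (W_subgroup k b n c m) x).
    by rewrite -val_W_Delta.
  apply: (mulgI (W_Delta k b n c m ^+ i)).
  have Dc' l (x : W k b n c m) : commute x (W_Delta k b n c m ^+ l).
    exact: commuteX.
  by rewrite mulgA e -Dc' -e [RHS]mulgA -(Dc' i y) mulgA.
split=> //; exists p => //.
by split=> //; rewrite rD cD.
Qed.

(** * The dual reflection representation of the triangle group *)

Section WordAction.
Variables (I : choiceType) (rels : seq (word I * word I)) (X : Type).
Variable f : I -> X -> X.

(** The sign of a letter is ignored because the generators will act by involutions, so a letter and
    its inverse act alike. *)
Definition word_act (w : word I) (x : X) : X := foldr (fun a => f a.1) x w.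

Lemma word_act_cat w1 w2 x : word_act (w1 ++ w2) x = word_act w1 (word_act w2 x).
Proof. by rewrite /word_act foldr_cat. Qed.

Hypothesis f_inv : forall i, involutive (f i).
Hypothesis f_rels : {in rels, forall r, word_act r.1 =1 word_act r.2}.

Lemma word_act_eq w1 w2 : word_eq rels w1 w2 -> word_act w1 =1 word_act w2.
Proof.
elim=> {w1 w2} //.
- by move=> w1 w2 _ e x; rewrite e.
- by move=> w1 w2 w3 _ e1 _ e2 x; rewrite e1.
- by move=> w1 w1' w2 w2' _ e1 _ e2 x; rewrite !word_act_cat e2 e1.
by move=> a x; rewrite /word_act /= f_inv.
Qed.

End WordAction.

(** * Alternating products of two reflections *)

Section Chebyshev.
Local Open Scope R_scope.
Variables (i j : 'I_3) (c : 'I_3 -> 'I_3 -> R).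

Definition vec := 'I_3 -> R.

(* x l is the value of a linear form on the l-th simple root, so refl is the
   action dual to the reflection representation. *)
Definition refl (a : 'I_3) (x : vec) : vec :=
  fun l => if l == a then - x a else x l + 2 * c a l * x a.

Lemma reflK a : involutive (refl a).
Proof.
move=> x; apply: funext => l; rewrite /refl eqxx.
by case: eqP => [->|_]; ring.
Qed.

(** The letter applied at step [q], counted from 0: first [j], then [i], and so on. *)
Definition altl (q : nat) : 'I_3 := if odd q then i else j.

Fixpoint alt_act (q : nat) (x : vec) : vec :=
  if q is p.+1 then refl (altl p) (alt_act p x) else x.

Variable theta : R.
Hypotheses (ij : i != j) (cij : c i j = cos theta) (cji : c j i = cos theta).

Lemma altlSS q : altl q.+2 = altl q.
Proof. by rewrite /altl /= negbK. Qed.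

Lemma alt_actS q x :
  alt_act q.+1 x (altl q) = - alt_act q x (altl q) /\
  alt_act q.+1 x (altl q.+1) =
    alt_act q x (altl q.+1) + 2 * cos theta * alt_act q x (altl q).
Proof.
split; rewrite /= /refl ?eqxx // /altl /=.
by case: (odd q); rewrite /= ?cij ?cji ?(negPf ij) // eq_sym (negPf ij).
Qed.

(* The coordinates along an alternating word satisfy the Chebyshev recurrence
   h'' = 2 cos(theta) h' - h, of which this is a first integral. *)
Lemma alt_act_invariant phi q x :
  alt_act q x (altl q.+1) * sin (INR q.+1 * theta + phi) +
  alt_act q x (altl q) * sin (INR q * theta + phi) =
  x i * sin (theta + phi) + x j * sin phi.
Proof.
elim: q => [|q <-].
  by rewrite /altl /= Rmult_1_l Rmult_0_l Rplus_0_l.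
have [e1 e2] := alt_actS q x.
rewrite e2 altlSS e1 !S_INR.
set A := INR q * theta + phi.
have -> : (INR q + 1 + 1) * theta + phi = A + 2 * theta by rewrite /A; ring.
have -> : (INR q + 1) * theta + phi = A + theta by rewrite /A; ring.
rewrite !sin_plus sin_2a cos_2a_cos.
have := sin2_cos2 theta; rewrite /Rsqr => e; ring_simplify.
nra.
Qed.

Lemma alt_act_iter p x :
  iter p (fun y => refl i (refl j y)) x = alt_act p.*2 x.
Proof. by elim: p => //= p ->; rewrite /altl /= odd_double. Qed.

Hypotheses (sin_gt0 : 0 < sin theta).

(** The combination is invariant under both reflections exactly when [al = c i l + be * cos theta]
    and [be = c j l + al * cos theta], a linear system of determinant [sin^2 theta]. *)
Lemma alt_act_third l x : l != i -> l != j ->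
  exists al be, forall q,
  alt_act q x l + al * alt_act q x i + be * alt_act q x j =
  x l + al * x i + be * x j.
Proof.
move=> li lj; have := sin2_cos2 theta; rewrite /Rsqr => sc.
have sn : sin theta * sin theta <> 0 by nra.
exists ((c i l + cos theta * c j l) / (sin theta * sin theta)).
exists ((c j l + cos theta * c i l) / (sin theta * sin theta)).
elim=> [//|p <-] /=; move: (alt_act p x) => y; rewrite /altl.
case: (odd p); rewrite /refl eqxx.
  rewrite (negPf li) eq_sym (negPf ij) cij.
  have : cos theta * cos theta = 1 - sin theta * sin theta by lra.
  set C := cos theta; set S := sin theta * sin theta in sn * => CC.
  field_simplify_eq => //.
  nra.
rewrite (negPf lj) (negPf ij) cji.
have : cos theta * cos theta = 1 - sin theta * sin theta by lra.
set C := cos theta; set S := sin theta * sin theta in sn * => CC.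
field_simplify_eq => //.
nra.
Qed.

(** After [2d] steps the phase of the first integral has advanced by [2 PI], which restores the
    coordinates [i] and [j]; [alt_act_third] then restores the third one. *)
Lemma alt_act_period d x l : INR d * theta = PI ->
  alt_act d.*2 x l = x l.
Proof.
move=> dPI.
have dd : INR d.*2 * theta = 2 * PI by rewrite -addnn plus_INR; lra.
(* The phase 0 isolates the coordinate [i], and the phase [- theta] isolates the coordinate [j]. *)
have e1 := alt_act_invariant 0 d.*2 x.
have e2 := alt_act_invariant (- theta) d.*2 x.
have sin2 y : sin (y + 2 * PI) = sin y by rewrite sin_plus sin_2PI cos_2PI; ring.
move: e1 e2; rewrite /altl /= odd_double /= -/(INR d.*2.+1) S_INR.
have -> : (INR d.*2 + 1) * theta + 0 = theta + 2 * PI by lra.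
have -> : (INR d.*2 + 1) * theta + - theta = 0 + 2 * PI by lra.
have -> : INR d.*2 * theta + 0 = 0 + 2 * PI by lra.
have -> : INR d.*2 * theta + - theta = - theta + 2 * PI by lra.
rewrite !sin2 Rplus_0_r Rplus_opp_r sin_0 sin_neg => e1 e2.
have ei : alt_act d.*2 x i = x i by nra.
have ej : alt_act d.*2 x j = x j by nra.
have [->//|li] := eqVneq l i; have [->//|lj] := eqVneq l j.
have [al [be /(_ d.*2)]] := alt_act_third x li lj.
by rewrite ei ej; lra.
Qed.

End Chebyshev.

Section TriangleAction.
Variables k n m : nat.
Hypotheses (k_ge2 : 2 <= k) (n_ge2 : 2 <= n) (m_ge2 : 2 <= m).
Local Notation T := (triangle_group k n m).
Local Notation r := (tri_gen k n m).

(* For i != j the sum i + j determines the edge {i, j}. *)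
Definition tri_label (i j : 'I_3) : nat := nth 0 [:: 0; k; n; m] (i + j).

Lemma tri_labelC i j : tri_label i j = tri_label j i.
Proof. by rewrite /tri_label addnC. Qed.

Lemma tri_label_ge2 i j : i != j -> 2 <= tri_label i j.
Proof. by move: i j; do 2![apply: ord3P]; rewrite -val_eqE /tri_label /= !inordK. Qed.

Lemma tri_gen_label i j : i != j -> ((r i * r j) ^+ tri_label i j = 1)%g.
Proof.
move: i j; do 2![apply: ord3P]; rewrite -val_eqE /tri_label /= !inordK //= => _.
- exact: tri_rel01.
- exact: tri_rel02.
- exact/expgn_swap/tri_rel01.
- exact: tri_rel12.
- exact/expgn_swap/tri_rel02.
- exact/expgn_swap/tri_rel12.
Qed.

Local Open Scope R_scope.

Definition tri_angle i j : R := PI / INR (tri_label i j).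
Definition tri_cos i j : R := cos (tri_angle i j).
Local Notation sigma := (refl tri_cos).

Lemma tri_angle_mul i j : i != j -> INR (tri_label i j) * tri_angle i j = PI.
Proof.
move=> ij; rewrite /tri_angle; field; apply: not_0_INR.
by have := tri_label_ge2 ij; case: tri_label.
Qed.

Lemma INR_le2 d : (2 <= d)%N -> 2 <= INR d.
Proof. by move=> d2; apply: (le_INR 2); apply/leP. Qed.

Lemma tri_angle_bounds i j : i != j -> 0 < tri_angle i j <= PI / 2.
Proof.
move=> ij; have := tri_angle_mul ij; have := INR_le2 (tri_label_ge2 ij).
by have := PI_RGT_0; split; nra.
Qed.

Lemma tri_sin_gt0 i j : i != j -> 0 < sin (tri_angle i j).
Proof.
by move=> ij; have := tri_angle_bounds ij => ?; apply: sin_gt_0; have := PI_RGT_0; lra.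
Qed.

Lemma tri_cosC i j : tri_cos i j = tri_cos j i.
Proof. by rewrite /tri_cos /tri_angle tri_labelC. Qed.

Lemma refl_period i j x : i != j ->
  iter (tri_label i j) (fun y => sigma i (sigma j y)) x = x.
Proof.
move=> ij; rewrite alt_act_iter; apply: funext => l.
apply: (alt_act_period (theta := tri_angle i j)) => //.
- by rewrite tri_cosC.
- exact: tri_sin_gt0.
- exact: tri_angle_mul.
Qed.

Lemma word_act_flatten d i j x :
  word_act sigma (flatten (nseq d [:: letter i; letter j])) x =
  iter d (fun y => sigma i (sigma j y)) x.
Proof. by elim: d => //= d <-. Qed.

Fact tri_act_rels : {in triangle_rels k n m, forall r,
  word_act sigma r.1 =1 word_act sigma r.2}.
Proof.
have nz : (inord 0 != inord 1 :> 'I_3) /\ (inord 0 != inord 2 :> 'I_3) /\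
   (inord 1 != inord 2 :> 'I_3) by rewrite -!val_eqE /= !inordK.
have [n01 [n02 n12]] := nz.
move=> w; rewrite !inE => /or4P[/eqP->|/eqP->|/eqP->|/or3P[]/eqP->] x /=.
1-3: by rewrite reflK.
- have := refl_period x n01; rewrite -word_act_flatten /tri_label /= !inordK //.
- have := refl_period x n02; rewrite -word_act_flatten /tri_label /= !inordK //.
- have := refl_period x n12; rewrite -word_act_flatten /tri_label /= !inordK //.
Qed.

Definition tri_act (g : T) (x : vec) : vec := word_act sigma (repr g) x.

Lemma tri_act_class w x : tri_act (class_of_word _ w) x = word_act sigma w x.
Proof.
by apply: (word_act_eq (@reflK _) tri_act_rels); apply: repr_class.
Qed.

Lemma tri_act1 x : tri_act 1%g x = x.
Proof. exact: (tri_act_class [::]). Qed.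

Lemma tri_actM g h x : tri_act (g * h)%g x = tri_act g (tri_act h x).
Proof.
rewrite -[g]class_of_repr -[h]class_of_repr -class_of_word_cat.
by rewrite !tri_act_class word_act_cat.
Qed.

Lemma tri_act_gen i x : tri_act (r i) x = sigma i x.
Proof. exact: (tri_act_class [:: letter i]). Qed.

Lemma tri_ind (Q : T -> Prop) : Q 1%g -> (forall i g, Q g -> Q (r i * g)%g) ->
  forall g, Q g.
Proof.
by move=> Q1 QM; apply: presented_ind => // i g; rewrite tri_genV; apply: QM.
Qed.

Definition lincomb (a b : R) (x y : vec) : vec := fun l => a * x l + b * y l.

Lemma tri_act_lin g a b x y :
  tri_act g (lincomb a b x y) = lincomb a b (tri_act g x) (tri_act g y).
Proof.
elim/tri_ind: g => [|i g IH]; first by rewrite !tri_act1.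
rewrite !tri_actM IH !tri_act_gen; apply: funext => l.
by rewrite /lincomb /refl; case: ifP => _; ring.
Qed.

(** The 3 x 3 determinant; each reflection changes its sign, so it detects the parity of a word. *)
Definition vol (x y z : vec) : R :=
  let a (v : vec) := v (inord 0) in let b (v : vec) := v (inord 1) in
  let c (v : vec) := v (inord 2) in
  a x * (b y * c z - c y * b z) - b x * (a y * c z - c y * a z)
  + c x * (a y * b z - b y * a z).

Lemma vol_refl i x y z : vol (sigma i x) (sigma i y) (sigma i z) = - vol x y z.
Proof.
by move: i; apply: ord3P; rewrite /vol /refl -!val_eqE /= !inordK //=; ring.
Qed.

Lemma vol_tri_act v x y z : let g := tri_prod k n m v in
  vol (tri_act g x) (tri_act g y) (tri_act g z) =
  if odd (size v) then - vol x y z else vol x y z.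
Proof.
elim: v => [|i v IH] /=; first by rewrite /tri_prod big_nil !tri_act1.
rewrite /tri_prod big_cons !tri_actM !tri_act_gen vol_refl -/(tri_prod k n m v) IH.
by case: (odd (size v)) => /=; ring.
Qed.

(** * Word length and the removal of alternating prefixes *)

Section Length.
Local Open Scope nat_scope.
Local Notation len := (@tri_length k n m).

Lemma tri_length_min v : len (tri_prod k n m v) <= size v.
Proof.
rewrite /tri_length; case: ex_minnP => d _; apply; apply/asboolP.
by exists v.
Qed.

Lemma tri_length_word g : exists2 v, size v = len g & g = tri_prod k n m v.
Proof. by rewrite /tri_length; case: ex_minnP => d /asboolP[v]; exists v. Qed.

Lemma tri_length_gen_le i g : len (r i * g)%g <= (len g).+1.
Proof.
have [v <- ->] := tri_length_word g.
by have := tri_length_min (i :: v); rewrite {1}/tri_prod big_cons.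
Qed.

Lemma tri_gen_gen i g : (r i * (r i * g) = g)%g.
Proof. by rewrite mulgA tri_gen_sqr mul1g. Qed.

Lemma tri_length_gen_ge i g : len g <= (len (r i * g)%g).+1.
Proof. by rewrite -{1}(tri_gen_gen i g) tri_length_gen_le. Qed.

(** The length moves by at most one, and its parity has to change. *)
Lemma tri_length_gen i g :
  len (r i * g)%g = (len g).+1 \/ len g = (len (r i * g)%g).+1.
Proof.
have := tri_length_gen_le i g; have := tri_length_gen_ge i g.
have : odd (len (r i * g)%g) != odd (len g).
  by rewrite odd_tri_lengthM odd_tri_length_gen; case: odd.
rewrite leq_eqVlt => ne /orP[/eqP->|]; first by right.
rewrite ltnS leq_eqVlt => /orP[/eqP e|lt] le; first by rewrite e eqxx in ne.
by left; apply/eqP; rewrite eqn_leq le.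
Qed.

(** The first letter of a shortest word for [g] shortens it. *)
Lemma tri_descent g : g <> 1%g -> exists i, len g = (len (r i * g)%g).+1.
Proof.
have [[|i v] sv gE] := tri_length_word g; first by rewrite gE /tri_prod big_nil.
move=> _; exists i; case: (tri_length_gen i g) => // e.
have := tri_length_min v; suff -> : tri_prod k n m v = (r i * g)%g.
  by rewrite e -sv /= ltnNge leqnSn.
by rewrite gE /tri_prod big_cons tri_gen_gen.
Qed.

(** Its rightmost factor is [r j], so that it acts on vectors as [alt_act i j]. *)
Fixpoint tri_alt (i j : 'I_3) (q : nat) : T :=
  if q is p.+1 then (r (altl i j p) * tri_alt i j p)%g else 1%g.

Lemma tri_altSr i j q : tri_alt i j q.+1 = (tri_alt j i q * r j)%g.
Proof.
elim: q => [|q IH]; first by rewrite /= mul1g mulg1.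
rewrite [LHS]/= -/(tri_alt i j q.+1) IH /= mulgA; congr (r _ * _ * _)%g.
by rewrite /altl /=; case: odd.
Qed.

Lemma tri_alt_double i j p : tri_alt i j p.*2 = ((r i * r j) ^+ p)%g.
Proof. by elim: p => //= p ->; rewrite /altl /= odd_double expgS !mulgA. Qed.

(** The alternating product of twice the label many factors is trivial; moving its letters one by
    one from the left to the other side yields the braid relation halfway. *)
Lemma tri_alt_braid i j : i != j ->
  tri_alt i j (tri_label i j) = tri_alt j i (tri_label i j).
Proof.
move=> ij; set d := tri_label i j.
suff H p : p <= d.*2 -> tri_alt i j (d.*2 - p) = tri_alt j i p.
  by rewrite -H -addnn ?leq_addl // addnK.
elim: p => [_|p IH lp]; first by rewrite subn0 tri_alt_double tri_gen_label.
rewrite [RHS]/= -(IH (ltnW lp)) -(subnSK lp) [RHS]/=.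
suff -> : altl i j (d.*2 - p.+1) = altl j i p by rewrite tri_gen_gen.
by rewrite /altl oddB //= odd_double; case: odd.
Qed.

Lemma tri_length_alt i j q g : len g <= len (tri_alt i j q * g)%g + q.
Proof.
elim: q => [|q IH] /=; first by rewrite mul1g addn0.
apply: leq_trans IH _; rewrite addnS -addSn leq_add2r -mulgA.
exact: tri_length_gen_ge.
Qed.

Lemma tri_length_alt_mono i j p q g : p <= q ->
  len (tri_alt i j p * g)%g <= len (tri_alt i j q * g)%g + (q - p).
Proof.
move=> pq; rewrite -{1}(subnKC pq); elim: (q - p) => [|d IH].
  by rewrite !addn0.
apply: leq_trans IH _; rewrite !addnS -addSn leq_add2r /= -mulgA.
exact: tri_length_gen_ge.
Qed.

(* Take q maximal such that removing q alternating letters from the left of g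
   lowers its length by q. *)
Lemma tri_alt_strip i j g : i != j ->
    len g < len (r i * g)%g -> len (r j * g)%g < len g ->
  exists q, [/\ 0 < q, q < tri_label i j, len (tri_alt i j q * g)%g < len g
    & forall a, a \in [:: altl i j q; altl i j q.+1] ->
      len (tri_alt i j q * g)%g < len (r a * (tri_alt i j q * g))%g].
Proof.
move=> ij asc desc; pose P q := len (tri_alt i j q * g)%g + q == len g.
have P1 : P 1.
  rewrite /P /= mulg1 /altl /= addn1 eq_sym.
  by case: (tri_length_gen j g) desc => [->|<-] //; rewrite ltnNge leqnSn.
have Pb q : P q -> q <= len g by move/eqP<-; rewrite leq_addl.
case: (ex_maxnP (ex_intro P 1 P1) Pb) => q /eqP Pq qmax.
have q_gt0 : 0 < q := qmax 1 P1.
have desc_q : len (tri_alt i j q * g)%g < len g by rewrite -Pq -addn1 leq_add2l.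
exists q; split=> //.
  (* If [q] reached the label [d], the braid relation would let [r i] act first. It raises the
     length, and the remaining [d - 1] letters lower it by at most [d - 1], so a drop by [d] is
     impossible. *)
  rewrite ltnNge; apply/negP => dq; set d := tri_label i j in dq.
  have := tri_length_alt_mono i j g dq; rewrite -(leq_add2r d) -addnA subnK // Pq.
  rewrite tri_alt_braid // -/d; have d_gt0 : 0 < d by rewrite ltnW // tri_label_ge2.
  rewrite -(prednK d_gt0) tri_altSr addnS -mulgA.
  have := tri_length_alt i j d.-1 (r i * g)%g.
  move=> l1 l2; have := leq_ltn_trans l1 l2.
  by rewrite ltnNge (ltnW asc).
move=> a; rewrite !inE => /orP[]/eqP->.
  (* The next letter of the alternation cannot lower the length, by maximality of [q]. *)
  case: (tri_length_gen (altl i j q) (tri_alt i j q * g)%g) => [->//|e].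
  have : P q.+1 by rewrite /P /= addnS -addSn -mulgA -e Pq.
  by move/qmax; rewrite ltnn.
(* The other letter is the one applied last. Undoing it leaves [q - 1] letters, which lower the
   length of [g] by at most [q - 1]. *)
have -> : altl i j q.+1 = altl i j q.-1 by rewrite -{1}(prednK q_gt0) altlSS.
have -> : tri_alt i j q = (r (altl i j q.-1) * tri_alt i j q.-1)%g.
  by rewrite -{1}(prednK q_gt0).
rewrite -mulgA tri_gen_gen -(ltn_add2r q.-1).
apply: leq_trans (tri_length_alt i j q.-1 g).
by rewrite mulgA -[(r _ * _)%g]/(tri_alt i j q.-1.+1) -addnS prednK // Pq.
Qed.

End Length.

(** A point inside the fundamental chamber: a form positive on every simple root. *)
Definition rho : vec := fun _ => 1.

Lemma tri_act_alt i j q g x :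
  tri_act (tri_alt i j q * g)%g x = alt_act i j tri_cos q (tri_act g x).
Proof.
by elim: q => [|q IH] /=; rewrite ?mul1g // -mulgA tri_actM tri_act_gen IH.
Qed.

(** Induction on the length. Stripping an alternating word in [i] and a descent [j] leaves a shorter
    element on which both letters are ascents, so both of its coordinates are nonnegative; the first
    integral carries this back to [g]. *)
Lemma tits_positivity g i : (tri_length g < tri_length (r i * g)%g)%N -> 0 <= tri_act g rho i.
Proof.
have [d] := ubnP (tri_length g); elim: d g i => // d IH g i gd asc.
have [->|] := pselect (g = 1%g); first by rewrite tri_act1 /rho; lra.
move=> /tri_descent [j desc].
have ij : i != j by apply/eqP => ij; move: asc; rewrite ij desc ltnNge leqnSn.
have [|q [q_gt0 qd vg vasc]] := tri_alt_strip ij asc; first by rewrite desc.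
set v := (tri_alt i j q * g)%g in vg vasc.
have pos a : a \in [:: altl i j q; altl i j q.+1] -> 0 <= tri_act v rho a.
  by move=> /vasc; apply: IH; apply: leq_trans vg _.
(* With phase 0 the coordinate [j] drops out, and the coordinate [i] times [sin theta] becomes a
   combination with coefficients [sin (q theta)] and [sin ((q + 1) theta)]. These are nonnegative
   because [q + 1] is at most the label. *)
have := alt_act_invariant (c := tri_cos) (theta := tri_angle i j) ij erefl
  (tri_cosC _ _) 0 q (tri_act g rho).
rewrite -tri_act_alt -/v !Rplus_0_r sin_0 Rmult_0_r Rplus_0_r.
have := pos _ (mem_head _ _).
have := pos (altl i j q.+1); rewrite !inE eqxx orbT => /(_ erefl).
have th_gt0 := (tri_angle_bounds ij).1.
have sq p : (p <= tri_label i j)%N -> 0 <= sin (INR p * tri_angle i j).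
  move=> pd; apply: sin_ge_0; first by have := pos_INR p; nra.
  rewrite -(tri_angle_mul ij); apply: Rmult_le_compat_r; first lra.
  by apply: le_INR; apply/leP.
have := sq _ qd; have := sq _ (ltnW qd); have := tri_sin_gt0 ij.
move: (sin _) (sin _) (sin _) (tri_act g rho i) => s1 s2 s3 x.
by move: (tri_act v rho _) (tri_act v rho _) => y z; nra.
Qed.

(** For a descent [i] of a nontrivial [g], positivity applies to [r i * g]; but that element sends
    [rho] to its reflection, whose coordinate [i] is -1. *)
Lemma tri_act_rho g : tri_act g rho = rho -> g = 1%g.
Proof.
move=> gr; apply: contrapT => /tri_descent [i desc].
have := @tits_positivity (r i * g)%g i; rewrite tri_gen_gen desc leqnn => /(_ erefl).
by rewrite tri_actM tri_act_gen gr /refl eqxx /rho; lra.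
Qed.

(** The basis dual to the simple roots; [axis l] spans the line fixed by the two reflections other
    than [l]. *)
Definition axis (l : 'I_3) : vec := fun a => if a == l then 1 else 0.

Lemma tri_cos_gt0 i j : i != j -> (2 < tri_label i j)%N -> 0 < tri_cos i j.
Proof.
move=> ij l3; have [th_gt0 _] := tri_angle_bounds ij.
have : 3 <= INR (tri_label i j) by rewrite (_ : 3 = INR 3); [apply/le_INR/leP|rewrite /=; ring].
have := tri_angle_mul ij; have := PI_RGT_0 => PI0 e l3R.
by apply: cos_gt_0; nra.
Qed.

Lemma ord3_third (a b : 'I_3) : exists l, (l != a) && (l != b).
Proof.
by move: a b; do 2![apply: ord3P];
  first [exists (inord 0); rewrite -!val_eqE /= !inordK //; done
        |exists (inord 1); rewrite -!val_eqE /= !inordK //; done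
        |exists (inord 2); rewrite -!val_eqE /= !inordK //; done].
Qed.

(** * Elements commuting with all products of two distinct reflections *)

Section Centralizer.
Variable z : T.
Hypothesis z_comm : forall i j, i != j -> monoid.commute z (r i * r j)%g.

(** The image [f] of the axis is again fixed by [r a * r b]. Hence the reflections [a] and [b] agree
    on [f], which gives [f a = - c * f b] and [f b = - c * f a] with [c^2 < 1]. *)
Lemma tri_act_axis a l : a != l -> tri_act z (axis l) a = 0.
Proof.
move=> al; have [b /andP[ba bl]] := ord3_third a l; rewrite eq_sym in ba.
have e : sigma a (sigma b (axis l)) = axis l.
  apply: funext => d; rewrite /refl /axis (negPf al) (negPf bl) (negPf ba).
  have [->|_] := eqVneq d a; first by rewrite (negPf al); ring.
  by have [->|_] := eqVneq d b; rewrite ?(negPf bl); ring.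
have := congr1 (fun g => tri_act g (axis l)) (z_comm ba).
rewrite /= !tri_actM !tri_act_gen e; set f := tri_act z _ => fE.
have fb : sigma a f = sigma b f by rewrite {1}fE reflK.
have := congr1 (fun h => h a) fb; have := congr1 (fun h => h b) fb.
rewrite /refl !eqxx (negPf ba) eq_sym (negPf ba) (tri_cosC b a).
have := tri_sin_gt0 ba; have := sin2_cos2 (tri_angle a b).
rewrite /Rsqr -/(tri_cos a b); move: (sin _) (tri_cos a b) => s c sc s_gt0 e1 e2.
have e3 : f a = - (c * f b) by lra.
have e4 : f b = - (c * f a) by lra.
have : f a * (s * s) = 0 by rewrite (_ : s * s = 1 - c * c); [rewrite e4 in e3; nra|lra].
by move/Rmult_integral => [//|]; nra.
Qed.

Local Notation lambda l := (tri_act z (axis l) l).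

Lemma tri_act_diag x a : tri_act z x a = lambda a * x a.
Proof.
have -> : tri_act z x = tri_act z (lincomb 1 1
  (lincomb (x (inord 0)) (x (inord 1)) (axis (inord 0)) (axis (inord 1)))
  (lincomb (x (inord 2)) 0 (axis (inord 2)) (axis (inord 2)))).
  congr tri_act; apply: funext; apply: ord3P;
  by rewrite /lincomb /axis -!val_eqE /= !inordK //=; ring.
have [n01 [n02 n12]] : (inord 0 != inord 1 :> 'I_3) /\ (inord 0 != inord 2 :> 'I_3) /\
   (inord 1 != inord 2 :> 'I_3) by rewrite -!val_eqE /= !inordK.
have := (n01, n02, n12); rewrite eq_sym (eq_sym (inord 0) (inord 2)) (eq_sym _ (inord 2)).
move=> [[n10 n20] n21].
rewrite !tri_act_lin; move: a; apply: ord3P; rewrite /lincomb.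
- by rewrite (tri_act_axis n01) (tri_act_axis n02); ring.
- by rewrite (tri_act_axis n10) (tri_act_axis n12); ring.
- by rewrite (tri_act_axis n20) (tri_act_axis n21); ring.
Qed.

(** Applied to [axis j], the product [r i * r j] has coordinate [i] equal to [- 2 cos], which is
    nonzero for a label above 2; commutation then equates the two eigenvalues. *)
Lemma eigenvalue_eq lam i j : (forall x a, tri_act z x a = lam a * x a) ->
  i != j -> (2 < tri_label i j)%N -> lam i = lam j.
Proof.
move=> diag ij l3; have := tri_cos_gt0 ij l3.
have := congr1 (fun g => tri_act g (axis j) i) (z_comm ij).
rewrite /= !tri_actM !tri_act_gen diag /refl eqxx (negPf ij) !diag.
rewrite /axis eqxx (negPf ij) (tri_cosC j i) => e c0.
nra.
Qed.

(** The two labels above 2 connect all three axes, so [z] acts as a scalar. An even element has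
    determinant 1, the scalar is therefore a real cube root of 1, and [z] fixes [rho]. *)
Lemma tri_center_trivial i j l : [&& i != j, j != l & l != i] ->
  (2 < tri_label i j)%N -> (2 < tri_label j l)%N ->
  ~~ odd (tri_length z) -> z = 1%g.
Proof.
case/and3P=> ij jl li lij ljl z_even.
have [lam diag] : exists lam, forall x a, tri_act z x a = lam a * x a.
  by exists (fun l => tri_act z (axis l) l); exact: tri_act_diag.
have eij := eigenvalue_eq diag ij lij; have ejl := eigenvalue_eq diag jl ljl.
have lamE a : lam a = lam j.
  have : [|| a == i, a == j | a == l].
    move: ij jl li; rewrite -!val_eqE /=; case: i j l a {lij ljl eij ejl}
      => [[|[|[|i]]] ?] // [[|[|[|j]]] ?] // [[|[|[|l]]] ?] // [[|[|[|a]]] ?] //.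
  by case/or3P => /eqP-> //.
have [v zE] := tri_prodP z.
have := vol_tri_act v (axis (inord 0)) (axis (inord 1)) (axis (inord 2)).
rewrite -zE /vol /= !diag !lamE.
have -> : odd (size v) = false.
  by apply: negbTE; rewrite -(odd_tri_length k n m) -zE.
rewrite /axis -!val_eqE /= !inordK //=; move: (lam j) lamE => x lamE e.
have x1 : x = 1.
  (* This is the factorization of [x^3 - 1] with the square completed in the quadratic factor. *)
  have : (x - 1) * ((x + 1 / 2) * (x + 1 / 2) + 3 / 4) = 0 by lra.
  by move/Rmult_integral => [|]; [lra|nra].
by apply: tri_act_rho; apply: funext => a; rewrite diag lamE x1 /rho; ring.
Qed.

End Centralizer.

End TriangleAction.

(** * Central elements when two labels equal 2 *)

Lemma pair_expg (A B : groupType) (x : A) (y : B) j :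
  ((x, y) : A * B) ^+ j = (x ^+ j, y ^+ j).
Proof. by elim: j => // j IH; rewrite !expgS IH. Qed.

Section Swap.
Variable A : groupType.

Definition pair_swap (x : A * A) : A * A := (x.2, x.1).

Fact pair_swap_morph : monoid_morphism pair_swap.
Proof. by split. Qed.

HB.instance Definition _ :=
  isUMagmaMorphism.Build (A * A)%type (A * A)%type pair_swap pair_swap_morph.

Lemma pair_swapK : involutive pair_swap.
Proof. by case. Qed.

Definition wreath2 := semi2 pair_swapK.
HB.instance Definition _ := Group.on wreath2.

End Swap.

(** * A monomial matrix model for two labels equal to 2 *)

Section DihedralModel.
Variable N : nat.
Hypothesis N_ge2 : 2 <= N.
Local Notation C := ('I_(N.*2.-1.+1)).
Local Notation g := (Zp_gen N.*2.-1).
Local Notation G0 := (wreath2 C).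

(* Monomial 2 x 2 matrices with entries of order 2N: the pair is the diagonal
   part and true stands for the swap. *)
Definition model_a : G0 := ((g ^+ 2, 1), false).
Definition model_b : G0 := ((1, 1), true).
Definition model_c : G0 := ((g, g^-1), true).
Local Notation a := model_a.
Local Notation b := model_b.
Local Notation c := model_c.

Lemma wreath2_eq (x y : G0) :
  x.1.1 = y.1.1 -> x.1.2 = y.1.2 -> x.2 = y.2 -> x = y.
Proof. by case: x => [[? ?] ?]; case: y => [[? ?] ?] /= -> -> ->. Qed.

(** The product is the scalar matrix [g], so the model sees the powers of [zeta] modulo [2N]. *)
Lemma model_abc : a * b * c = ((g, g), false) :> G0.
Proof. by apply: wreath2_eq; rewrite /= ?gsimp ?mul1g // expg2 mulgK. Qed.
Lemma model_bca : b * c * a = ((g, g), false) :> G0.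
Proof. by apply: wreath2_eq; rewrite /= ?gsimp ?mul1g // expg2 mulKg. Qed.
Lemma model_cab : c * a * b = ((g, g), false) :> G0.
Proof. by apply: wreath2_eq; rewrite /= ?gsimp ?mul1g // expg2 mulKg. Qed.
Lemma model_aN : a ^+ N = 1.
Proof.
rewrite [LHS]semi2_expg pair_expg expg1n -expgnA mul2n Zp_gen_expg1 // prednK //.
by rewrite double_gt0; apply: ltnW.
Qed.
Lemma model_b2 : b ^+ 2 = 1.
Proof. by apply: wreath2_eq; rewrite /= ?gsimp. Qed.
Lemma model_c2 : c ^+ 2 = 1.
Proof. by apply: wreath2_eq; rewrite /= ?gsimp. Qed.

End DihedralModel.

(** * Normal forms and central elements when two generators are involutions *)

Section Dihedral.
Variables (G : groupType) (a b c zeta : G) (N : nat).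
Hypotheses (N_ge2 : 2 <= N) (aN : a ^+ N = 1) (b2 : b ^+ 2 = 1) (c2 : c ^+ 2 = 1)
  (abc : a * b * c = zeta) (bca : b * c * a = zeta) (cab : c * a * b = zeta).

Lemma zeta_commute_a : commute zeta a.
Proof. by rewrite /commute -{1}abc -{1}bca -!mulgA. Qed.
Lemma zeta_commute_b : commute zeta b.
Proof. by rewrite /commute -{1}bca -{1}cab -!mulgA. Qed.
Let bV : b^-1 = b. Proof. exact/mulg1_eq. Qed.
Let cV : c^-1 = c. Proof. exact/mulg1_eq. Qed.
Let aV : a^-1 = a ^+ N.-1.
Proof. by apply/mulg1_eq; rewrite -expgS prednK // ltnW. Qed.

Lemma dihedral_cE : c = b * a ^+ N.-1 * zeta.
Proof. by rewrite -aV -abc -(mulgA a) -mulgA mulKg mulgA -[b * b]/(b ^+ 2) b2 mul1g. Qed.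

(** Since [c = (a * b)^-1 * zeta] is an involution and [zeta] is central here,
    [(a * b)^2 = zeta^2]. *)
Lemma dihedral_ba : b * a = a ^+ N.-1 * b * zeta ^+ 2.
Proof.
have zc : commute (a * b)^-1 zeta.
  by apply/commute_sym/commuteV/commuteM; [exact: zeta_commute_a|exact: zeta_commute_b].
have e : (a * b) ^+ 2 = zeta ^+ 2.
  have : ((a * b)^-1 * zeta) ^+ 2 = 1 by rewrite -abc mulKg.
  by rewrite expgMn // expVgn => /mulg1_eq; rewrite invgK.
have bz : commute b (zeta ^+ 2) by apply/commuteX/commute_sym/zeta_commute_b.
rewrite -aV -mulgA bz -e !mulgA mulVg mul1g -[RHS]mulgA.
by rewrite -[X in _ = _ * X]/(b ^+ 2) b2 mulg1.
Qed.

(** Natural exponents suffice: the inverses of [a], [b], [c] are nonnegative powers of these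
    elements, and [c] itself involves only a positive power of [zeta]. *)
Definition dihedral_form (x : G) : Prop :=
  exists i (d : bool) j, x = a ^+ i * b ^+ d * zeta ^+ j.

Lemma dihedral_form_a i x : dihedral_form x -> dihedral_form (a ^+ i * x).
Proof.
by move=> [i' [d [j ->]]]; exists (i + i')%N, d, j; rewrite expgnDr !mulgA.
Qed.

Lemma dihedral_form_zeta x : dihedral_form x -> dihedral_form (zeta * x).
Proof.
move=> [i [d [j ->]]]; exists i, d, j.+1; rewrite expgS !mulgA -(mulgA zeta).
have zc : commute zeta (a ^+ i * b ^+ d).
  by apply: commuteM; apply: commuteX; [exact: zeta_commute_a|exact: zeta_commute_b].
by rewrite zc.
Qed.

Lemma dihedral_form_b x : dihedral_form x -> dihedral_form (b * x).
Proof.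
move=> [i [d [j ->]]].
elim: i => [|i IH].
  rewrite mul1g mulgA; case: d; last by exists 0%N, true, j; rewrite mulg1 mul1g.
  by exists 0%N, false, j; rewrite -[b * b ^+ 1]/(b ^+ 2) b2 !mul1g.
have bz : commute b (zeta ^+ 2) by apply/commuteX/commute_sym/zeta_commute_b.
rewrite expgS -!mulgA (mulgA b) dihedral_ba -(mulgA _ b) bz -!mulgA.
apply: dihedral_form_a.
apply: dihedral_form_zeta; apply: dihedral_form_zeta.
by rewrite (mulgA (a ^+ i)).
Qed.

Lemma dihedral_form_c x : dihedral_form x -> dihedral_form (c * x).
Proof.
rewrite dihedral_cE -!mulgA => fx.
by apply: dihedral_form_b; apply: dihedral_form_a; apply: dihedral_form_zeta.
Qed.

Lemma dihedral_formP x y : x \in [:: a; b; c; a^-1; b^-1; c^-1] ->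
  dihedral_form y -> dihedral_form (x * y).
Proof.
rewrite !inE aV bV cV => xE fy; move: xE.
do ?case/orP; move/eqP->; do ?[exact: dihedral_form_b|exact: dihedral_form_c
  |exact: dihedral_form_a].
by rewrite -(expg1 a); apply: dihedral_form_a.
Qed.

Lemma dihedral_form1 : dihedral_form 1.
Proof. by exists 0%N, false, 0%N; rewrite !mulg1. Qed.

Local Notation d := (N.*2.-1).
Local Notation g := (Zp_gen d).
Variable phi : grp_morphism G (wreath2 'I_d.+1).
Hypotheses (phi_a : phi a = model_a N) (phi_b : phi b = model_b N)
  (phi_c : phi c = model_c N).

Let dE : d.+1 = N.*2.
Proof. by rewrite prednK // double_gt0 ltnW. Qed.

Lemma dihedral_model_zeta j : phi zeta ^+ j = ((g ^+ j, g ^+ j), false).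
Proof.
rewrite -abc !gmulfM phi_a phi_b phi_c model_abc [LHS]semi2_expg.
by rewrite pair_expg.
Qed.

Lemma dihedral_model_a i : phi a ^+ i = ((g ^+ (2 * i), 1), false).
Proof.
by rewrite phi_a [LHS]semi2_expg pair_expg expg1n expgnA.
Qed.

(** Commutation with [a] may fail by powers of [zeta] when [N] exceeds 2, but must be exact when
    [N = 2]; it excludes the factor [b] from the normal form. Exact commutation with [b] or [c] then
    removes the power of [a]. *)
Lemma dihedral_center z l1 l2 : dihedral_form z ->
    zeta ^+ l1 * (z * a) = zeta ^+ l2 * (a * z) -> (2 < N) || (l1 == l2) ->
    z * b = b * z \/ z * c = c * z ->
  exists j, z = zeta ^+ j.
Proof.
move=> [i [[] [j zE]]] za Nl zbc; last first.
  (* Without the factor [b], comparing diagonal entries gives [2i + j = j] modulo [2N], hence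
     [a ^+ i = 1]. *)
  exists j; rewrite zE mulg1 [X in X * _](_ : _ = 1) ?mul1g //.
  suff /dvdnP[q ->] : N %| i by rewrite mulnC expgnA aN expg1n.
  have : 2 * i + j = j %[mod d.+1].
    apply: Zp_gen_expg_eq; rewrite expgnDr.
    case: zbc => /(congr1 phi); rewrite !gmulfM zE mulg1 gmulfM !gmulfXn dihedral_model_zeta
      dihedral_model_a ?phi_b ?phi_c => /(congr1 (fun x : wreath2 _ => x.1.2)) /=.
      by rewrite mul1g mul1g mulg1.
    by rewrite mul1g Zp_mulgC => /mulgI.
  move/eqP; rewrite -[X in _ == X %[mod _]]add0n eqn_modDr mod0n dE -mul2n.
  by rewrite -/(dvdn _ _) dvdn_pmul2l.
(* With the factor [b], the two diagonal entries give [l1 = l2 + 2] and [l1 + 2 = l2] modulo [2N].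
   So [2N] divides 4, and even 2 when [l1 = l2]. *)
exfalso; move: za => /(congr1 phi); rewrite zE !gmulfM !gmulfXn dihedral_model_zeta.
rewrite dihedral_model_zeta dihedral_model_zeta dihedral_model_a phi_a phi_b => e.
move: (congr1 (fun x : wreath2 _ => x.1.1) e) (congr1 (fun x : wreath2 _ => x.1.2) e).
rewrite /= !(mulg1, mul1g) -!expgnDr.
move=> /Zp_gen_expg_eq e1 /Zp_gen_expg_eq e2.
have {}e1 : l1 = l2 + 2 %[mod d.+1].
  by apply/eqP; rewrite -(eqn_modDr (2 * i + j)) e1 addnA.
have {}e2 : l1 + 2 = l2 %[mod d.+1].
  by apply/eqP; rewrite -(eqn_modDr j) -addnA (addnC 2) e2.
have : d.+1 %| 4.
  rewrite /dvdn -(mod0n d.+1) -(eqn_modDl l2) addn0 -e2.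
  by rewrite -(modnDml l1) e1 modnDml -addnA.
have [/eqP l12|ne] := boolP (l1 == l2).
  have : d.+1 %| 2 by rewrite /dvdn -(mod0n d.+1) -(eqn_modDl l2) addn0 -e1 l12.
  by rewrite dE => /dvdn_leq => /(_ isT); rewrite -[2]/(1.*2) leq_double leqNgt N_ge2.
rewrite (negPf ne) orbF in Nl.
by rewrite dE => /dvdn_leq => /(_ isT); rewrite -[4]/(2.*2) leq_double leqNgt Nl.
Qed.

End Dihedral.

(** * The center of W *)

Section DihedralJ.
Variables k n m : nat.
Local Notation J := (J k n m).
Local Notation s := (Js k n m).
Local Notation t := (Jt k n m).
Local Notation u := (Ju k n m).
Local Notation zeta := (Jzeta k n m).
Let stu : s * t * u = zeta. Proof. by []. Qed.
Let tus : t * u * s = zeta. Proof. by rewrite -J_stu. Qed.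
Let ust : u * s * t = zeta. Proof. by rewrite -J_tus. Qed.

(** The dihedral analysis for [(a, b, c) = (s, t, u)]; the two lemmas after it treat the cyclic
    rotations of this triple. *)
Lemma J_center_s z l1 l2 : 2 <= k -> n = 2 -> m = 2 ->
    zeta ^+ l1 * (z * s) = zeta ^+ l2 * (s * z) -> (2 < k) || (l1 == l2) ->
    z * t = t * z \/ z * u = u * z ->
  exists j, z = zeta ^+ j.
Proof.
move=> k_ge2 n2 m2.
have t2 : t ^+ 2 = 1 by rewrite -(J_tn k n m) n2.
have u2 : u ^+ 2 = 1 by rewrite -(J_um k n m) m2.
have [||||| f [fs ft fu]] := @J_hom k n m _ (model_a k) (model_b k) (model_c k).
- exact: model_aN.
- by rewrite n2; exact: model_b2.
- by rewrite m2; exact: model_c2.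
- by rewrite model_abc // model_bca.
- by rewrite model_bca // model_cab.
apply: (dihedral_center k_ge2 (J_sk k n m) stu fs ft fu).
have D := dihedral_formP k_ge2 (J_sk k n m) t2 u2 stu tus ust.
elim/J_ind: z => [|z|z|z|z|z|z]; first exact: dihedral_form1.
all: by apply: D; rewrite !inE eqxx ?orbT.
Qed.

Lemma J_center_t z l1 l2 : 2 <= n -> m = 2 -> k = 2 ->
    zeta ^+ l1 * (z * t) = zeta ^+ l2 * (t * z) -> (2 < n) || (l1 == l2) ->
    z * u = u * z \/ z * s = s * z ->
  exists j, z = zeta ^+ j.
Proof.
move=> n_ge2 m2 k2.
have s2 : s ^+ 2 = 1 by rewrite -(J_sk k n m) k2.
have u2 : u ^+ 2 = 1 by rewrite -(J_um k n m) m2.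
have [||||| f [fs ft fu]] := @J_hom k n m _ (model_c n) (model_a n) (model_b n).
- by rewrite k2; exact: model_c2.
- exact: model_aN.
- by rewrite m2; exact: model_b2.
- by rewrite model_abc // model_cab.
- by rewrite model_abc // model_bca.
apply: (dihedral_center n_ge2 (J_tn k n m) tus ft fu fs).
have D := dihedral_formP n_ge2 (J_tn k n m) u2 s2 tus ust stu.
elim/J_ind: z => [|z|z|z|z|z|z]; first exact: dihedral_form1.
all: by apply: D; rewrite !inE eqxx ?orbT.
Qed.

Lemma J_center_u z l1 l2 : 2 <= m -> k = 2 -> n = 2 ->
    zeta ^+ l1 * (z * u) = zeta ^+ l2 * (u * z) -> (2 < m) || (l1 == l2) ->
    z * s = s * z \/ z * t = t * z ->
  exists j, z = zeta ^+ j.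
Proof.
move=> m_ge2 k2 n2.
have s2 : s ^+ 2 = 1 by rewrite -(J_sk k n m) k2.
have t2 : t ^+ 2 = 1 by rewrite -(J_tn k n m) n2.
have [||||| f [fs ft fu]] := @J_hom k n m _ (model_b m) (model_c m) (model_a m).
- by rewrite k2; exact: model_b2.
- by rewrite n2; exact: model_c2.
- exact: model_aN.
- by rewrite model_cab // model_bca.
- by rewrite model_cab // model_abc.
apply: (dihedral_center m_ge2 (J_um k n m) ust fu fs ft).
have D := dihedral_formP m_ge2 (J_um k n m) s2 t2 ust stu tus.
elim/J_ind: z => [|z|z|z|z|z|z]; first exact: dihedral_form1.
all: by apply: D; rewrite !inE eqxx ?orbT.
Qed.

End DihedralJ.

Section Center.
Variables k b n c m : nat.
Hypotheses (n_gt0 : 0 < n) (m_gt0 : 0 < m) (coprime_nm : coprime n m)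
  (k_ge2 : 2 <= k) (bn_ge2 : 2 <= b * n) (cm_ge2 : 2 <= c * m).
Local Notation J := (J k (b * n) (c * m)).
Local Notation s := (Js k (b * n) (c * m)).
Local Notation t := (Jt k (b * n) (c * m)).
Local Notation u := (Ju k (b * n) (c * m)).
Local Notation zeta := (Jzeta k (b * n) (c * m)).
Local Notation T := (triangle_group k (b * n) (c * m)).
Local Notation r := (tri_gen k (b * n) (c * m)).
Local Notation WJ := (W_subgroup k b n c m).

Lemma W_center_to_tri (w : W k b n c m) : center (W k b n c m) w ->
  s2val (J_to_tri k (b * n) (c * m)) (subgroup_incl _ w) = 1.
Proof.
case: J_to_tri => /= f [fs ft fu] fK cw; set z := subgroup_incl WJ w.
have fz : f zeta = 1 by apply/fK; exists 0%N, 1%N; rewrite mul1g.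
have zW x : subgroup_set WJ x -> z * x = x * z.
  by move=> Wx; have /(congr1 (subgroup_incl WJ)) := cw (subgroup_elt Wx).
(* Every [x] in J agrees with an element of W up to powers of [zeta], which [f] kills; so [f z]
   commutes with the whole image of J. *)
have zf x : f (z * x) = f (x * z).
  have [w' [i [j [Ww' e]]]] := W_zeta_cover n_gt0 m_gt0 coprime_nm x.
  have fx : f x = f w' by have := congr1 f e; rewrite !gmulfM !gmulfXn fz !expg1n !mul1g.
  by rewrite !gmulfM fx -!gmulfM zW.
have zC x : exists l1 l2, zeta ^+ l1 * (z * x) = zeta ^+ l2 * (x * z).
  have /fK[l1 [l2 e]] : f (z * x * (x * z)^-1) = 1 by rewrite gmulfM gmulfV zf mulgV.
  by exists l1, l2; rewrite -e -mulgA mulgVK.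
have ker : (exists j, z = zeta ^+ j) -> f z = 1.
  by case=> j ->; rewrite gmulfXn fz expg1n.
have z_even : ~~ odd (tri_length (f z)) := J_to_tri_even fs ft fu z.
have zT i j : i != j -> commute (f z) (r i * r j).
  move=> _; have [x <-] : exists x, f x = r i * r j.
    by apply: (J_to_tri_onto fs ft) => /=; rewrite odd_tri_lengthM !odd_tri_length_gen.
  by rewrite /commute -!gmulfM zf.
have [n01 [n02 n12]] : (inord 0 != inord 1 :> 'I_3) /\ (inord 0 != inord 2 :> 'I_3) /\
   (inord 1 != inord 2 :> 'I_3) by rewrite -!val_eqE /= !inordK.
have := (n01, n02, n12); rewrite eq_sym (eq_sym (inord 0) (inord 2)) (eq_sym _ (inord 2)).
move=> [[n10 n20] n21].
have C := tri_center_trivial k_ge2 bn_ge2 cm_ge2 zT _ _ _ z_even.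
(* Here [n] and [m] are coprime divisors of 2, so one of them is 1 and [t] or [u] lies in W. As [s]
   lies in W too, all commutations are exact, and [k] may also be 2. *)
have case_s : b * n <= 2 -> c * m <= 2 -> f z = 1.
  move=> bn2 cm2; apply: ker.
  have {}bn2 : (b * n = 2)%N by apply/eqP; rewrite eqn_leq bn2.
  have {}cm2 : (c * m = 2)%N by apply/eqP; rewrite eqn_leq cm2.
  have e : zeta ^+ 0 * (z * s) = zeta ^+ 0 * (s * z) by rewrite zW //; apply: W_s.
  apply: (J_center_s k_ge2 bn2 cm2 e); first by rewrite eqxx orbT.
  have : (n == 1%N) || (m == 1%N).
    move: coprime_nm; have : n %| 2 by rewrite -bn2 dvdn_mull.
    have : m %| 2 by rewrite -cm2 dvdn_mull.
    move=> /dvdn_leq-/(_ isT) m2 /dvdn_leq-/(_ isT) n2.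
    by case: n m m2 n2 n_gt0 m_gt0 => [|[|[|]]] // [|[|[|]]].
  case/orP => /eqP one; [left|right]; apply: zW.
    by rewrite -(expg1 t); apply: W_t_dvd; rewrite one.
  by rewrite -(expg1 u); apply: W_u_dvd; rewrite one.
have [k3|k2] := ltnP 2 k; have [bn3|bn2] := ltnP 2 (b * n);
  have [cm3|cm2] := ltnP 2 (c * m).
(* The middle index is the vertex shared by two edges whose labels exceed 2. *)
- by apply: (C (inord 1) (inord 0) (inord 2));
    rewrite ?n10 ?n02 ?n21 /tri_label /= ?inordK.
- by apply: (C (inord 1) (inord 0) (inord 2));
    rewrite ?n10 ?n02 ?n21 /tri_label /= ?inordK.
- by apply: (C (inord 0) (inord 1) (inord 2));
    rewrite ?n01 ?n12 ?n20 /tri_label /= ?inordK.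
- exact: case_s.
- by apply: (C (inord 0) (inord 2) (inord 1));
    rewrite ?n02 ?n21 ?n10 /tri_label /= ?inordK.
(* Now [t] need not lie in W and commutes with [z] only up to powers of [zeta], which is enough
   because its label exceeds 2; exact commutation comes from [s]. *)
- apply: ker; have [l1 [l2 e]] := zC t.
  have {}k2 : k = 2 by apply/eqP; rewrite eqn_leq k2.
  have {}cm2 : (c * m = 2)%N by apply/eqP; rewrite eqn_leq cm2.
  apply: (J_center_t bn_ge2 cm2 k2 e); first by rewrite bn3.
  by right; apply: zW; apply: W_s.
- apply: ker; have [l1 [l2 e]] := zC u.
  have {}k2 : k = 2 by apply/eqP; rewrite eqn_leq k2.
  have {}bn2 : (b * n = 2)%N by apply/eqP; rewrite eqn_leq bn2.
  apply: (J_center_u cm_ge2 k2 bn2 e); first by rewrite cm3.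
  by left; apply: zW; apply: W_s.
- exact: case_s.
Qed.

End Center.

Local Close Scope group_scope.
Local Close Scope classical_set_scope.

Theorem theorem1p5 (k b n c m : nat)
    (k_gt0 : 0 < k) (b_gt0 : 0 < b) (n_gt0 : 0 < n) (c_gt0 : 0 < c)
    (m_gt0 : 0 < m) (k_ge2 : 2 <= k) (bn_ge2 : 2 <= b * n)
    (cm_ge2 : 2 <= c * m) (coprime_nm : coprime n m) :
  let D : subgroup (W k b n c m) := cyclic_subgroup (W_Delta k b n c m) in
  [/\ exists p : grp_morphism (W k b n c m) (Wplus k (b * n) (c * m)),
        short_exact (subgroup_incl D) p,
      center (W k b n c m) = D :> set (W k b n c m)
    & exists p : grp_morphism (W k b n c m) (Wplus k (b * n) (c * m)),
        central_extension (subgroup_incl D) p].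
Proof.
apply: W_extension_of_center => //; exact: W_center_to_tri.
Qed.
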